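(* Under the assumptions stated in the context (Assumption 1, Assumption 3$^*$ and Assumption 4(i), in the limit $N,T \rightarrow \infty$ with $N/T \rightarrow \kappa^2$, $0<\kappa<\infty$), and with $W_{NT}$ and $C_{NT}$ as defined in the context, the score function satisfies \begin{align*} \nabla L_{NT}(\beta) \, &= \, 2 \, W_{NT} \, (\beta-\beta^0) \, - \, \frac 2 {\sqrt{NT}} \, C_{NT} \, + \frac 1 {NT} \, \nabla R_{NT}(\beta) \; , \end{align*} where the remainder $\nabla R_{NT}(\beta)$ satisfies for any sequence $\eta_{NT}\rightarrow 0$: \begin{align*} \sup_{\{\beta :\left\| \beta -\beta^{0} \right\| \leq \eta_{NT}\}} \frac{ \left\| \nabla R_{NT}(\beta) \right\| } { \sqrt{NT} \left(1 + \sqrt{NT} \, \left\| \beta -\beta^{0} \right\| \right) } = o_{p}\left( 1 \right) . \end{align*}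
   Context: Model: $Y = \beta^0\cdot X + \lambda^0 f^{0\prime} + e$, with $Y$, $X_k$ ($k=1,\ldots,K$), $e$ being $N\times T$ matrices, $\beta\cdot X=\sum_k \beta_k X_k$, $\lambda^0$ an $N\times R$ matrix of factor loadings and $f^0$ a $T\times R$ matrix of factors ($R$ known). The profile objective function is $L_{NT}(\beta)=\min_{\lambda,f}\frac{1}{NT}\|Y-\beta\cdot X-\lambda f'\|_F^2$. Assumptions: (Assumption 1) $\mathrm{plim}_{N,T\to\infty}\lambda^{0\prime}\lambda^0/N>0$ and $\mathrm{plim}_{N,T\to\infty} f^{0\prime}f^0/T>0$; (Assumption 3$^*$) $\|e\|=o_p(N^{2/3})$ (spectral norm); (Assumption 4(i)) $\mathrm{plim}_{N,T\to\infty}(NT)^{-1}\sum_{i,t}X_{it}X_{it}'>0$; limit $N,T\to\infty$ with $N/T\to\kappa^2$, $0<\kappa<\infty$. $M_A=\mathbb{I}-A(A'A)^{\dagger}A'$. $W_{NT}$ is the $K\times K$ matrix with $W_{NT,k_1k_2}=(NT)^{-1}\mathrm{Tr}(M_{f^0}X_{k_1}'M_{\lambda^0}X_{k_2})$, and $C_{NT}$ is the $K$-vector with $C_{NT,k}=C^{(1)}_k+C^{(2)}_k$, where $C^{(1)}_k=\frac{1}{\sqrt{NT}}\mathrm{Tr}(M_{f^0}e'M_{\lambda^0}X_k)$ and $C^{(2)}_k=-\frac{1}{\sqrt{NT}}\big[\mathrm{Tr}(eM_{f^0}e'M_{\lambda^0}X_kf^0(f^{0\prime}f^0)^{-1}(\lambda^{0\prime}\lambda^0)^{-1}\lambda^{0\prime})+\mathrm{Tr}(e'M_{\lambda^0}eM_{f^0}X_k'\lambda^0(\lambda^{0\prime}\lambda^0)^{-1}(f^{0\prime}f^0)^{-1}f^{0\prime})+\mathrm{Tr}(e'M_{\lambda^0}X_kM_{f^0}e'\lambda^0(\lambda^{0\prime}\lambda^0)^{-1}(f^{0\prime}f^0)^{-1}f^{0\prime})\big]$.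 $\nabla$ denotes the gradient with respect to $\beta$; $R_{NT}(\beta)$ is defined by $L_{NT}(\beta)=L_{NT}(\beta^0)-\frac{2}{\sqrt{NT}}(\beta-\beta^0)'C_{NT}+(\beta-\beta^0)'W_{NT}(\beta-\beta^0)+(NT)^{-1}R_{NT}(\beta)$. *)

(* Defs.v *)
From HB Require Import structures.
From mathcomp Require Import all_boot all_order all_algebra.
From mathcomp Require Import all_classical all_reals all_analysis.
Set Implicit Arguments. Unset Strict Implicit. Unset Printing Implicit Defensive.
Import Order.TTheory GRing.Theory Num.Theory.
Import numFieldNormedType.Exports.
Local Open Scope classical_set_scope.
Local Open Scope ring_scope.

Section Defs.
Variable R : realType.

Definition frob m n (A : 'M[R]_(m, n)) : R :=
  Num.sqrt (\sum_(i < m) \sum_(j < n) A i j ^+ 2).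

Definition spec m n (A : 'M[R]_(m, n)) : R :=
  sup [set x | exists v : 'cV[R]_n, frob v <= 1 /\ x = frob (A *m v)].

Definition is_MP m n (A : 'M[R]_(m, n)) (B : 'M[R]_(n, m)) : Prop :=
  [/\ A *m B *m A = A, B *m A *m B = B,
      (A *m B)^T = A *m B & (B *m A)^T = B *m A].
Definition MPinv m n (A : 'M[R]_(m, n)) : 'M[R]_(n, m) :=
  xget 0 [set B | is_MP A B].

Definition Mproj m n (A : 'M[R]_(m, n)) : 'M[R]_m :=
  1%:M - A *m MPinv (A^T *m A) *m A^T.

Definition posdef k (S : 'M[R]_k) : Prop :=
  forall v : 'rV[R]_k, v != 0 -> 0 < (v *m S *m v^T) 0 0.

Definition bdot K m n (b : 'rV[R]_K) (X : 'I_K -> 'M[R]_(m, n)) : 'M[R]_(m, n) :=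
  \sum_(k < K) b 0 k *: X k.

Definition Ymodel K m n r (b0 : 'rV[R]_K) (X : 'I_K -> 'M[R]_(m, n))
  (lam : 'M[R]_(m, r)) (f : 'M[R]_(n, r)) (e : 'M[R]_(m, n)) : 'M[R]_(m, n) :=
  bdot b0 X + lam *m f^T + e.

Definition Lprof K m n r (Y : 'M[R]_(m, n)) (X : 'I_K -> 'M[R]_(m, n))
  (b : 'rV[R]_K) : R :=
  inf [set x | exists (lam : 'M[R]_(m, r)) (f : 'M[R]_(n, r)),
        x = (m * n)%:R^-1 * frob (Y - bdot b X - lam *m f^T) ^+ 2].

Definition Wmat K m n r (X : 'I_K -> 'M[R]_(m, n))
  (lam : 'M[R]_(m, r)) (f : 'M[R]_(n, r)) : 'M[R]_K :=
  \matrix_(k1 < K, k2 < K)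
    ((m * n)%:R^-1 * \tr (Mproj f *m (X k1)^T *m Mproj lam *m X k2)).

Definition Cvec K m n r (X : 'I_K -> 'M[R]_(m, n))
  (lam : 'M[R]_(m, r)) (f : 'M[R]_(n, r)) (e : 'M[R]_(m, n)) : 'rV[R]_K :=
  let s := Num.sqrt (m * n)%:R in
  let Mf := Mproj f in let Ml := Mproj lam in
  let iLL := invmx (lam^T *m lam) in let iFF := invmx (f^T *m f) in
  \row_(k < K)
    (s^-1 * \tr (Mf *m e^T *m Ml *m X k)
     - s^-1 * (\tr (e *m Mf *m e^T *m Ml *m X k *m f *m iFF *m iLL *m lam^T)
              + \tr (e^T *m Ml *m e *m Mf *m (X k)^T *m lam *m iLL *m iFF *m f^T)
              + \tr (e^T *m Ml *m X k *m Mf *m e^T *m lam *m iLL *m iFF *m f^T))).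

(* R_NT(beta), defined by
   L(beta) = L(beta0) - 2/sqrt(NT) (beta-beta0)'C + (beta-beta0)'W(beta-beta0) + R(beta)/(NT) *)
Definition Rrem K m n r (b0 : 'rV[R]_K) (X : 'I_K -> 'M[R]_(m, n))
  (lam : 'M[R]_(m, r)) (f : 'M[R]_(n, r)) (e : 'M[R]_(m, n)) (b : 'rV[R]_K) : R :=
  let Y := Ymodel b0 X lam f e in
  let L := Lprof r Y X in
  let db := b - b0 in
  (m * n)%:R * (L b - L b0
     + 2 / Num.sqrt (m * n)%:R * (db *m (Cvec X lam f e)^T) 0 0
     - (db *m Wmat X lam f *m db^T) 0 0).

Definition grad K (F : 'rV[R]_K -> R) (b : 'rV[R]_K) : 'rV[R]_K :=
  \row_(k < K) ('d F b (delta_mx 0 k : 'rV[R]_K)).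

Variables (d : measure_display) (Omega : measurableType d) (P : probability Omega R).

(* A sequence of (not necessarily measurable) events has outer probability -> 0 *)
Definition vanishing (A : nat -> set Omega) : Prop :=
  forall delta : R, 0 < delta -> \forall n \near \oo,
    exists B, [/\ measurable B, A n `<=` B & (P B <= delta%:E)%E].

Definition op1 (Xn : nat -> Omega -> R) : Prop :=
  forall eps : R, 0 < eps -> vanishing (fun n => [set w | eps < `|Xn n w|]).

Definition plim_mx k l (Mn : nat -> Omega -> 'M[R]_(k, l)) (S : 'M[R]_(k, l)) : Prop :=
  forall i j, op1 (fun n w => Mn n w i j - S i j).

End Defs.

(* Main.v *)
(* Scale by sqrt(NT) and write A(b) = L + E(b), where L is the rank-r signal and E is
   small in spectral norm. The profile objective is the squared Frobenius distance from A
   to the matrices of rank at most r, attained at A U U' for an orthonormal U maximising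
   |A U|. Rotating one column of U shows that the residual D = A - A U U' is orthogonal to
   A U U' on both sides, is spectrally at most |E|, and that A U U' has a spectral gap
   above it. Two consequences follow.
   - The best approximation is Lipschitz in A, so by the envelope argument the objective is
     differentiable with gradient 2 D, with a quadratic remainder.
   - Writing L^+ for the pseudo-inverse, M = 1 - L L^+ and Mf = 1 - L^+ L, the
     orthogonality relations give
       D = M E Mf - M E L^+ E Mf - (L^+)' E' M E Mf - M E Mf E' (L^+)' + O(|E|^3)
     in Frobenius norm, every error term containing a factor L^+ of bounded Frobenius norm.
   The linear term yields W and C^(1), the part of the quadratic term in the noise alone
   yields C^(2), and what is left is O(|e|^3 + |e| |b - b0| + |b - b0|^2) after scaling. *)

(* The noise is small only in spectral norm; its scaled Frobenius norm need not vanish. A product of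
   noise matrices is therefore small in Frobenius norm only if some factor has bounded Frobenius
   norm, a role played by the pseudo-inverse of the signal. The order three is dictated by the rate.
   With s = sqrt(NT), |e| = o(N^(2/3)) gives s (|e|/s)^3 = |e|^3/(NT) = o(N/T) = o(1), whereas s
   (|e|/s)^2 need not be small. The quadratic noise term must be kept explicitly, and this is what
   C^(2) does. A bound on R says nothing about its gradient, so the expansion is made on the
   residual D, that is, on the gradient itself. Singular vectors and eigenvalue perturbation never
   enter: optimality of U supplies all the spectral information. *)
Require Import Defs.
From HB Require Import structures.
From mathcomp Require Import all_boot all_order all_algebra.
From mathcomp Require Import all_classical all_reals all_analysis.
From mathcomp Require Import ring lra.
Import Order.TTheory GRing.Theory Num.Theory.
Import numFieldNormedType.Exports.
Set Implicit Arguments. Unset Strict Implicit. Unset Printing Implicit Defensive.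
Local Open Scope classical_set_scope.
Local Open Scope ring_scope.

(** * The Frobenius inner product and operator bounds *)

Section Frobenius.
Variable R : realType.

Definition dot m n (A B : 'M[R]_(m, n)) : R := \tr (A^T *m B).

Lemma dotE m n (A B : 'M[R]_(m, n)) : dot A B = \sum_i \sum_j A i j * B i j.
Proof.
rewrite /dot exchange_big /=; apply: eq_bigr => j _.
by rewrite !mxE; apply: eq_bigr => i _; rewrite !mxE.
Qed.

Lemma trmx_scale m n (c : R) (A : 'M[R]_(m, n)) : (c *: A)^T = c *: A^T.
Proof. exact: linearZ. Qed.

Lemma addmx_entry m n (A B : 'M[R]_(m, n)) i j : (A + B) i j = A i j + B i j.
Proof. by rewrite mxE. Qed.

Lemma oppmx_entry m n (A : 'M[R]_(m, n)) i j : (- A) i j = - A i j.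
Proof. by rewrite mxE. Qed.

Lemma scalemx_entry m n (c : R) (A : 'M[R]_(m, n)) i j : (c *: A) i j = c * A i j.
Proof. by rewrite mxE. Qed.

Lemma dotC m n (A B : 'M[R]_(m, n)) : dot A B = dot B A.
Proof. by rewrite !dotE; do 2!apply: eq_bigr => ? _; rewrite mulrC. Qed.

Lemma dotDl m n (A B C : 'M[R]_(m, n)) : dot (A + B) C = dot A C + dot B C.
Proof. by rewrite /dot linearD /= mulmxDl linearD. Qed.

Lemma dotDr m n (A B C : 'M[R]_(m, n)) : dot A (B + C) = dot A B + dot A C.
Proof. by rewrite dotC dotDl !(dotC A). Qed.

Lemma dotNl m n (A B : 'M[R]_(m, n)) : dot (- A) B = - dot A B.
Proof. by rewrite /dot linearN /= mulNmx linearN. Qed.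

Lemma dotNr m n (A B : 'M[R]_(m, n)) : dot A (- B) = - dot A B.
Proof. by rewrite dotC dotNl dotC. Qed.

Lemma dotBl m n (A B C : 'M[R]_(m, n)) : dot (A - B) C = dot A C - dot B C.
Proof. by rewrite dotDl dotNl. Qed.

Lemma dotBr m n (A B C : 'M[R]_(m, n)) : dot A (B - C) = dot A B - dot A C.
Proof. by rewrite dotDr dotNr. Qed.

Lemma dotZl m n (c : R) (A B : 'M[R]_(m, n)) : dot (c *: A) B = c * dot A B.
Proof. by rewrite /dot linearZ /= -scalemxAl linearZ. Qed.

Lemma dotZr m n (c : R) (A B : 'M[R]_(m, n)) : dot A (c *: B) = c * dot A B.
Proof. by rewrite dotC dotZl dotC. Qed.

Lemma dot0l m n (A : 'M[R]_(m, n)) : dot 0 A = 0.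
Proof. by rewrite /dot trmx0 mul0mx mxtrace0. Qed.

Lemma dot_suml m n I (s : seq I) (F : I -> 'M[R]_(m, n)) B :
  dot (\sum_(i <- s) F i) B = \sum_(i <- s) dot (F i) B.
Proof.
by elim/big_rec2: _ => [|i x y _ <- ]; rewrite ?dot0l ?dotDl.
Qed.

Lemma dot_tr m n (A B : 'M[R]_(m, n)) : dot A^T B^T = dot A B.
Proof. by rewrite /dot trmxK mxtrace_mulC -mxtrace_tr trmx_mul trmxK. Qed.

Lemma dot_mull m n p (A : 'M[R]_(m, n)) (B : 'M[R]_(n, p)) C :
  dot (A *m B) C = dot B (A^T *m C).
Proof. by rewrite /dot trmx_mul -mulmxA. Qed.

Lemma dot_mulr m n p (A : 'M[R]_(m, n)) (B : 'M[R]_(n, p)) C :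
  dot (A *m B) C = dot A (C *m B^T).
Proof.
by rewrite /dot trmx_mul -mulmxA mxtrace_mulC mulmxA.
Qed.

Lemma frob_ge0 m n (A : 'M[R]_(m, n)) : 0 <= frob A.
Proof. exact: sqrtr_ge0. Qed.
Hint Resolve frob_ge0 : core.

Lemma frob_sq m n (A : 'M[R]_(m, n)) : frob A ^+ 2 = dot A A.
Proof.
rewrite sqr_sqrtr ?dotE; last by do 2!apply: sumr_ge0 => ? _; exact: sqr_ge0.
by do 2!apply: eq_bigr => ? _; rewrite expr2.
Qed.

Lemma dot_ge0 m n (A : 'M[R]_(m, n)) : 0 <= dot A A.
Proof. by rewrite -frob_sq sqr_ge0. Qed.

Lemma frob_dot m n (A : 'M[R]_(m, n)) : frob A = Num.sqrt (dot A A).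
Proof. by rewrite -frob_sq sqrtr_sqr ger0_norm. Qed.

Lemma frob0 m n : frob (0 : 'M[R]_(m, n)) = 0.
Proof. by rewrite frob_dot dot0l sqrtr0. Qed.

Lemma frob_eq0 m n (A : 'M[R]_(m, n)) : (frob A == 0) = (A == 0).
Proof.
apply/eqP/eqP => [A0|->]; last exact: frob0.
have := frob_sq A; rewrite A0 expr0n dotE => /esym/eqP.
rewrite psumr_eq0 => [/allP A1|i _]; last by apply: sumr_ge0 => j _; rewrite -expr2 sqr_ge0.
apply/matrixP => i j; have := A1 i (mem_index_enum i).
rewrite psumr_eq0 => [/allP A2|j' _]; last by rewrite -expr2 sqr_ge0.
by have := A2 j (mem_index_enum j); rewrite mulf_eq0 orbb mxE => /eqP.
Qed.

Lemma frobN m n (A : 'M[R]_(m, n)) : frob (- A) = frob A.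
Proof. by rewrite !frob_dot dotNl dotNr opprK. Qed.

Lemma frobZ m n c (A : 'M[R]_(m, n)) : frob (c *: A) = `|c| * frob A.
Proof.
by rewrite !frob_dot dotZl dotZr mulrA -expr2 sqrtrM ?sqr_ge0// sqrtr_sqr.
Qed.

Lemma frob_tr m n (A : 'M[R]_(m, n)) : frob A^T = frob A.
Proof. by rewrite !frob_dot dot_tr. Qed.

Lemma frob_le m n p q (A : 'M[R]_(m, n)) (B : 'M[R]_(p, q)) :
  dot A A <= dot B B -> frob A <= frob B.
Proof. by rewrite !frob_dot; exact: ler_wsqrtr. Qed.

Lemma dot_le_frob m n (A B : 'M[R]_(m, n)) : dot A B <= frob A * frob B.
Proof.
have [->|A0] := eqVneq A 0; first by rewrite dot0l frob0 mul0r.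
have a0 : 0 < dot A A by rewrite -frob_sq exprn_gt0// lt_def frob_eq0 A0 frob_ge0.
(* Up to the factor |A|^2 this is the component of [B] orthogonal to [A]; its squared norm is |A|^2
   (|A|^2 |B|^2 - <A,B>^2). *)
have := dot_ge0 (dot A A *: B - dot A B *: A).
rewrite dotBl !dotBr !dotZl !dotZr (dotC B A) => h.
have {h}: 0 <= dot A A * (dot A A * dot B B - dot A B ^+ 2) by apply: le_trans h _; lra.
rewrite pmulr_rge0// subr_ge0 -!frob_sq -exprMn => h.
by rewrite (le_trans (ler_norm _))// -ler_sqr ?nnegrE ?mulr_ge0// real_normK ?num_real.
Qed.

Lemma normr_dot_le m n (A B : 'M[R]_(m, n)) : `|dot A B| <= frob A * frob B.
Proof.
by rewrite ler_norml dot_le_frob lerNl -dotNl -(frobN A) dot_le_frob.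
Qed.

Lemma ler_frobD m n (A B : 'M[R]_(m, n)) : frob (A + B) <= frob A + frob B.
Proof.
rewrite -ler_sqr ?nnegrE ?addr_ge0// frob_sq dotDl !dotDr -!frob_sq (dotC B A).
have := dot_le_frob A B; lra.
Qed.

Lemma ler_frobB m n (A B : 'M[R]_(m, n)) : frob (A - B) <= frob A + frob B.
Proof. by rewrite -(frobN B) ler_frobD. Qed.

Lemma ler_frob_sum m n I (s : seq I) (F : I -> 'M[R]_(m, n)) :
  frob (\sum_(i <- s) F i) <= \sum_(i <- s) frob (F i).
Proof.
elim/big_rec2: _ => [|i x y _ h]; first by rewrite frob0.
by rewrite (le_trans (ler_frobD _ _))// lerD2l.
Qed.

Lemma frob_sq_col m n (A : 'M[R]_(m, n)) :
  frob A ^+ 2 = \sum_j frob (col j A) ^+ 2.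
Proof.
rewrite frob_sq dotE exchange_big; apply: eq_bigr => j _.
by rewrite frob_sq dotE; apply: eq_bigr => i _; rewrite big_ord1 !mxE.
Qed.

(** A bound in place of the spectral norm itself: bounds pass to products, sums and transposes
    without any supremum being handled. *)
Definition opb m n (a : R) (A : 'M[R]_(m, n)) : Prop :=
  forall v : 'cV[R]_n, frob (A *m v) <= a * frob v.

Lemma frob_mul_opbl m n p a (A : 'M[R]_(m, n)) (B : 'M[R]_(n, p)) :
  0 <= a -> opb a A -> frob (A *m B) <= a * frob B.
Proof.
move=> a0 hA; rewrite -ler_sqr ?nnegrE ?mulr_ge0// exprMn !frob_sq_col mulr_sumr.
apply: ler_sum => j _; rewrite -exprMn ler_sqr ?nnegrE ?mulr_ge0//.
by rewrite !colE -mulmxA.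
Qed.

(** |A'v|^2 = <v, A A'v> is at most |v| a |A'v|; dividing by |A'v| avoids singular values. *)
Lemma opb_tr m n a (A : 'M[R]_(m, n)) : 0 <= a -> opb a A -> opb a A^T.
Proof.
move=> a0 hA v; have [->|x0] := eqVneq (frob (A^T *m v)) 0; first by rewrite mulr_ge0.
have x1 : 0 < frob (A^T *m v) by rewrite lt_def x0 frob_ge0.
rewrite -(ler_pM2r x1) -expr2 frob_sq dot_mull trmxK (le_trans (dot_le_frob _ _))//.
have := hA (A^T *m v); have := frob_ge0 v; nra.
Qed.

Lemma frob_mul_opbr m n p a (A : 'M[R]_(m, n)) (B : 'M[R]_(n, p)) :
  0 <= a -> opb a B -> frob (A *m B) <= a * frob A.
Proof.
by move=> a0 /(opb_tr a0) h; rewrite -frob_tr trmx_mul -(frob_tr A) frob_mul_opbl.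
Qed.

Lemma opbM m n p a b (A : 'M[R]_(m, n)) (B : 'M[R]_(n, p)) :
  0 <= a -> opb a A -> opb b B -> opb (a * b) (A *m B).
Proof.
by move=> a0 hA hB v; rewrite -mulmxA (le_trans (hA _))// -mulrA ler_wpM2l.
Qed.

Lemma opbD m n a b (A B : 'M[R]_(m, n)) : opb a A -> opb b B -> opb (a + b) (A + B).
Proof.
by move=> hA hB v; rewrite mulmxDl (le_trans (ler_frobD _ _))// mulrDl lerD.
Qed.

Lemma opbN m n a (A : 'M[R]_(m, n)) : opb a A -> opb a (- A).
Proof. by move=> hA v; rewrite mulNmx frobN. Qed.

Lemma opbB m n a b (A B : 'M[R]_(m, n)) : opb a A -> opb b B -> opb (a + b) (A - B).
Proof. by move=> hA hB; exact/opbD/opbN. Qed.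

Lemma opbW m n a b (A : 'M[R]_(m, n)) : a <= b -> opb a A -> opb b A.
Proof. by move=> ab hA v; rewrite (le_trans (hA v))// ler_wpM2r. Qed.

Lemma opbZ m n a c (A : 'M[R]_(m, n)) : opb a A -> opb (`|c| * a) (c *: A).
Proof. by move=> hA v; rewrite -scalemxAl frobZ -mulrA ler_wpM2l. Qed.

Lemma frob_mul m n p (A : 'M[R]_(m, n)) (B : 'M[R]_(n, p)) :
  frob (A *m B) <= frob A * frob B.
Proof.
suff h : opb (frob A) A by exact: frob_mul_opbl.
move=> v; rewrite -ler_sqr ?nnegrE ?mulr_ge0// exprMn frob_sq dotE frob_sq dotE mulr_suml.
apply: ler_sum => i _; rewrite big_ord1 -expr2.
have -> : (A *m v) i ord0 = dot (row i A)^T v.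
  by rewrite dotE mxE; apply: eq_bigr => j _; rewrite big_ord1 !mxE.
rewrite -real_normK ?num_real//.
have -> : \sum_j A i j * A i j = frob (row i A)^T ^+ 2.
  by rewrite frob_sq dotE; apply: eq_bigr => j _; rewrite big_ord1 !mxE.
by rewrite -exprMn ler_sqr ?nnegrE ?mulr_ge0// normr_dot_le.
Qed.

Lemma opb_frob m n (A : 'M[R]_(m, n)) : opb (frob A) A.
Proof. by move=> v; exact: frob_mul. Qed.

Lemma opb_spec m n (A : 'M[R]_(m, n)) : opb (spec A) A.
Proof.
have hs : has_sup [set x | exists v : 'cV[R]_n, frob v <= 1 /\ x = frob (A *m v)].
  split; first by exists 0, 0; rewrite mulmx0 !frob0.
  exists (frob A) => _ [v [v1 ->]].
  by rewrite (le_trans (frob_mul _ _))// ler_piMr.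
move=> v; have [->|v0] := eqVneq v 0; first by rewrite mulmx0 !frob0 mulr0.
have v1 : 0 < frob v by rewrite lt_def frob_eq0 v0 frob_ge0.
rewrite -ler_pdivrMr//; apply: ub_le_sup => /=; first by case: hs.
exists ((frob v)^-1 *: v); rewrite frobZ -scalemxAr frobZ ger0_norm ?invr_ge0//.
by rewrite mulVf ?gt_eqF// mulrC.
Qed.

Lemma spec_ge0 m n (A : 'M[R]_(m, n)) : 0 <= spec A.
Proof.
apply: ub_le_sup.
  exists (frob A) => _ [v [v1 ->]].
  by rewrite (le_trans (frob_mul _ _))// ler_piMr.
by exists 0; rewrite mulmx0 !frob0.
Qed.

Lemma opb_proj n (P : 'M[R]_n) : P^T = P -> P *m P = P -> opb 1 P.
Proof.
move=> Pt PP v; rewrite mul1r.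
have [->|x0] := eqVneq (frob (P *m v)) 0; first by [].
have x1 : 0 < frob (P *m v) by rewrite lt_def x0 frob_ge0.
rewrite -(ler_pM2r x1) -expr2 frob_sq dot_mull Pt mulmxA PP; exact: dot_le_frob.
Qed.

Lemma proj_compl n (P : 'M[R]_n) : P^T = P -> P *m P = P ->
  [/\ (1%:M - P)^T = 1%:M - P, (1%:M - P) *m (1%:M - P) = 1%:M - P & opb 1 (1%:M - P)].
Proof.
move=> Pt PP; have c1 : (1%:M - P)^T = 1%:M - P by rewrite linearB /= trmx1 Pt.
have c2 : (1%:M - P) *m (1%:M - P) = 1%:M - P.
  by rewrite mulmxBl !mulmxBr !mul1mx mulmx1 PP subrr subr0.
by split=> //; exact: opb_proj.
Qed.

End Frobenius.
#[export] Hint Extern 0 (is_true (_ <= frob _)) => solve [apply: frob_ge0] : core.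

(* Linear identities between matrices, treating products as atoms. *)
Ltac mx_lin :=
  apply/matrixP => i j; rewrite !(addmx_entry, oppmx_entry, scalemx_entry); ring.

(** * Compactness and differentiability *)

Section Analysis.
Variable R : realType.

Section EntrywiseContinuity.
Variable T : topologicalType.

(** Entrywise, so that continuity of products and traces reduces to finite sums of real
    functions. *)
Definition mx_continuous m n (f : T -> 'M[R]_(m, n)) : Prop :=
  forall i j, continuous (fun v => f v i j).

Lemma mx_continuous_cst m n (A : 'M[R]_(m, n)) : mx_continuous (fun=> A).
Proof. by move=> i j v; exact: cvg_cst. Qed.

Lemma mx_continuousM m n p (f : T -> 'M[R]_(m, n)) (g : T -> 'M[R]_(n, p)) :
  mx_continuous f -> mx_continuous g -> mx_continuous (fun v => f v *m g v).
Proof.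
move=> cf cg i j.
have -> : (fun v => (f v *m g v) i j) = (fun v => \sum_k f v i k * g v k j).
  by apply/funext => v; rewrite mxE.
move=> v; apply: cvg_big => [|k _]; first exact: add_continuous.
by apply: cvgM; [exact: cf|exact: cg].
Qed.

Lemma mx_continuous_tr m n (f : T -> 'M[R]_(m, n)) :
  mx_continuous f -> mx_continuous (fun v => (f v)^T).
Proof.
move=> cf i j; have -> : (fun v => (f v)^T i j) = (fun v => f v j i).
  by apply/funext => v; rewrite mxE.
exact: cf.
Qed.

Lemma continuous_trace n (f : T -> 'M[R]_n) :
  mx_continuous f -> continuous (fun v => \tr (f v)).
Proof.
by move=> cf v; apply: cvg_big => [|k _]; [exact: add_continuous|exact: cf].
Qed.

Lemma closed_mx_eq m n (f : T -> 'M[R]_(m, n)) (A : 'M[R]_(m, n)) :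
  mx_continuous f -> closed [set v | f v = A].
Proof.
move=> cf.
have -> : [set v | f v = A] =
    \bigcap_(ij in [set: 'I_m * 'I_n]) ((fun v => f v ij.1 ij.2) @^-1` [set x | x = A ij.1 ij.2]).
  apply/seteqP; split=> [v /= fA ij _ /=|v /= h]; first by rewrite fA.
  by apply/matrixP => i j; exact: (h (i, j) I).
apply: closed_bigI => ij _; apply: preimage_closed; last exact: closed_eq.
by move=> v _; exact: cf.
Qed.

End EntrywiseContinuity.

Lemma mx_continuous_id m n : mx_continuous (@id 'M[R]_(m, n)).
Proof. by move=> i j; exact: coord_continuous. Qed.

Lemma mx_continuous_vec m n : mx_continuous (fun v : 'rV[R]_(m * n) => vec_mx v).
Proof.
move=> i j; have -> : (fun v : 'rV[R]_(m * n) => vec_mx v i j) =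
    (fun v => v 0 (mxvec_index i j)).
  by apply/funext => v; rewrite mxE.
exact: coord_continuous.
Qed.

Lemma compact_sub_cube n (A : set 'rV[R]_n) : closed A ->
  (forall v, A v -> forall i, `|v 0 i| <= 1) -> compact A.
Proof.
move=> cA hA; apply: (subclosed_compact cA (rV_compact (fun=> @segment_compact R (-1) 1))).
by move=> v /hA h i; rewrite /= in_itv /= -ler_norml h.
Qed.

Lemma normr_entry_le m n (A : 'M[R]_(m, n)) i j : `|A i j| <= frob A.
Proof.
rewrite -ler_sqr ?nnegrE// real_normK ?num_real// frob_sq dotE.
rewrite (bigD1 i)//= (bigD1 j)//= -expr2 -addrA lerDl addr_ge0//.
  by apply: sumr_ge0 => k _; rewrite -expr2 sqr_ge0.
by do 2!apply: sumr_ge0 => ? _; rewrite -expr2 sqr_ge0.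
Qed.

(* Of all orthonormal [U], [Stiefel_argmax A U] selects those spanning a space
   of dominant right singular vectors of [A]. *)
Definition Stiefel_argmax m n r (A : 'M[R]_(m, n)) (U : 'M[R]_(n, r)) : Prop :=
  U^T *m U = 1%:M /\
  forall V : 'M[R]_(n, r), V^T *m V = 1%:M -> frob (A *m V) <= frob (A *m U).

(** Flattened to row vectors, the orthonormal matrices form a closed subset of a cube, since their
    columns are unit vectors; a continuous function attains its maximum there. *)
Lemma Stiefel_argmax_exists m n r (A : 'M[R]_(m, n)) (V0 : 'M[R]_(n, r)) :
  V0^T *m V0 = 1%:M -> exists U : 'M[R]_(n, r), Stiefel_argmax A U.
Proof.
move=> V0V0.
pose S := [set v : 'rV[R]_(n * r) | (vec_mx v)^T *m vec_mx v = 1%:M :> 'M[R]_r].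
have cS : compact S.
  apply: compact_sub_cube.
    apply: closed_mx_eq; apply: mx_continuousM; last exact: mx_continuous_vec.
    exact/mx_continuous_tr/mx_continuous_vec.
  move=> v Sv i; case/mxvec_indexP: i => i j.
  have -> : v 0 (mxvec_index i j) = vec_mx v i j by rewrite mxE.
  have := normr_entry_le (col j (vec_mx v)) i 0; rewrite mxE => /le_trans; apply.
  have : ((vec_mx v)^T *m vec_mx v) j j = 1 by rewrite Sv mxE eqxx.
  rewrite !mxE => h; rewrite -(@ler_pXn2r _ 2)// ?nnegrE// expr1n frob_sq dotE -h.
  by apply: ler_sum => k _; rewrite big_ord1 !mxE.
have S0 : S !=set0 by exists (mxvec V0); rewrite /S /= mxvecK.
have cf : continuous (fun v : 'rV[R]_(n * r) => dot (A *m vec_mx v) (A *m vec_mx v)).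
  have c1 : mx_continuous (fun v : 'rV[R]_(n * r) => A *m vec_mx v).
    by apply: mx_continuousM; [exact: mx_continuous_cst|exact: mx_continuous_vec].
  by apply: continuous_trace; apply: mx_continuousM => //; exact: mx_continuous_tr.
have [c cS' hc] := EVT_max_rV S0 cS (continuous_subspaceT cf).
exists (vec_mx c); split; first by move: cS'; rewrite inE.
move=> V VV; apply: frob_le; have := hc (mxvec V); rewrite mxvecK; apply.
by rewrite inE /S /= mxvecK.
Qed.

(** The constant is the minimum of the form on the compact unit sphere. It makes positive
    definiteness quantitative, hence stable under small perturbations. *)
Lemma posdef_coercive k (S : 'M[R]_k) : posdef S ->
  exists2 c, 0 < c & forall v : 'rV[R]_k, c * frob v ^+ 2 <= (v *m S *m v^T) 0 0.
Proof.
(* For [k = 0] the unit sphere is empty and there is no minimum to take. *)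
move=> Spos; have [k0|k0] := posnP k.
  exists 1 => // v; have -> : v = 0.
    by apply/rowP => j; have := ltn_ord j; rewrite [X in (_ < X)%N]k0.
  by rewrite frob0 !mul0mx mxE expr2 mul0r mulr0.
pose A := [set v : 'rV[R]_k | v *m v^T = 1%:M].
have frobA v : A v -> frob v = 1.
  rewrite /A /= => h; rewrite -frob_tr frob_dot /dot trmxK h mxtrace1.
  by rewrite sqrtr1.
have cA : compact A.
  apply: compact_sub_cube.
    by apply: closed_mx_eq; apply: mx_continuousM; first exact: mx_continuous_id;
       exact/mx_continuous_tr/mx_continuous_id.
  by move=> v Av i; rewrite -(frobA v)// normr_entry_le.
have normA (v : 'rV[R]_k) : v != 0 -> A ((frob v)^-1 *: v).
  rewrite /A /= -frob_eq0 => v0; rewrite linearZ /= -scalemxAl -scalemxAr scalerA.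
  apply/matrixP => i j; rewrite !ord1 [LHS]mxE [RHS]mxE eqxx.
  have -> : (v *m v^T) 0 0 = frob v ^+ 2.
    by rewrite -frob_tr frob_sq /dot trmxK /mxtrace big_ord1.
  by rewrite -expr2 -exprMn mulVf// expr1n.
have A0 : A !=set0.
  have v0 : delta_mx 0 (Ordinal k0) != 0 :> 'rV[R]_k.
    apply/eqP => /matrixP/(_ 0 (Ordinal k0)); rewrite !mxE !eqxx => /eqP.
    by rewrite oner_eq0.
  by exists ((frob (delta_mx 0 (Ordinal k0) : 'rV[R]_k))^-1 *: delta_mx 0 (Ordinal k0)); exact: normA.
have cf : continuous (fun v : 'rV[R]_k => (v *m S *m v^T) 0 0).
  suff h : mx_continuous (fun v : 'rV[R]_k => v *m S *m v^T) by exact: h.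
  apply: mx_continuousM; last exact/mx_continuous_tr/mx_continuous_id.
  by apply: mx_continuousM; [exact: mx_continuous_id|exact: mx_continuous_cst].
have [c Ac hc] := EVT_min_rV A0 cA (continuous_subspaceT cf).
rewrite inE in Ac; exists ((c *m S *m c^T) 0 0).
  apply: Spos; apply/eqP => c0; move: (frobA _ Ac); rewrite c0 frob0 => /eqP.
  by rewrite eq_sym oner_eq0.
move=> v; have [->|v0] := eqVneq v 0.
  by rewrite frob0 expr0n mulr0 mul0mx mul0mx [leRHS]mxE.
have := hc _ (mem_set (normA v v0)).
rewrite linearZ /= -!scalemxAl -scalemxAr scalerA [leRHS]mxE.
rewrite -invfM -expr2 [leRHS]mulrC ler_pdivlMr// exprn_gt0// lt_def frob_ge0 andbT.
by rewrite frob_eq0.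
Qed.

Lemma ler_frob_mx_norm m n (A : 'M[R]_(m, n)) : frob A <= Num.sqrt (m * n)%:R * `|A|.
Proof.
rewrite -ler_sqr ?nnegrE ?mulr_ge0 ?sqrtr_ge0 ?normr_ge0// exprMn frob_sq dotE sqr_sqrtr ?ler0n//.
have -> : (m * n)%:R * `|A| ^+ 2 = \sum_(i < m) \sum_(j < n) `|A| ^+ 2.
  by rewrite !sumr_const !card_ord -mulrnA mulr_natl mulnC.
do 2!apply: ler_sum => ? _; rewrite -expr2 -real_normK ?num_real//.
rewrite ler_sqr ?nnegrE ?normr_ge0// [leRHS]mx_normrE.
exact: (le_bigmax _ (fun ij => `|A ij.1 ij.2|) (_, _)).
Qed.

(** Lets a gradient be read off an inequality, with no formula for the function. The differential
    refers to the maximum norm and the hypothesis to the Frobenius norm, whence the factor [s] in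
    the proof. *)
Lemma quadratic_remainder_diff k (F : 'rV[R]_k -> R) (b g : 'rV[R]_k) (C d : R) :
  0 < d ->
  (forall h, frob h <= d -> `|F (b + h) - F b - (h *m g^T) 0 0| <= C * frob h ^+ 2) ->
  differentiable F b /\ grad F b = g.
Proof.
move=> d0 hF.
pose V : normedModType R := 'rV[R]_k; pose W : normedModType R := R.
pose L : V -> W := fun h : 'rV[R]_k => (h *m g^T) 0 0.
have Llin : linear L.
  by move=> a u v; rewrite /L mulmxDl -scalemxAl 2!mxE.
pose LL : {linear V -> W} := HB.pack L (GRing.isLinear.Build _ _ _ _ L Llin).
have cL : continuous LL.
  suff h : mx_continuous (fun h : 'rV[R]_k => h *m g^T) by exact: h.
  by apply: mx_continuousM; [exact: mx_continuous_id|exact: mx_continuous_cst].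
have exp : (F : V -> W) \o shift (b : V) = cst (F b : W) + LL +o_ (0 : V) id.
  apply/eqaddoP => eps eps0.
  set s : R := Num.sqrt (1 * k)%:R.
  have s0 : 0 <= s by exact: sqrtr_ge0.
  have C0 := normr_ge0 C.
  have e1 : 0 < d / (s + 1) by rewrite divr_gt0//; lra.
  have e2 : 0 < eps / ((`|C| + 1) * (s ^+ 2 + 1)).
    by rewrite divr_gt0// mulr_gt0//; have := sqr_ge0 s; lra.
  (* The first radius puts [h] inside the ball of radius [d]; the second makes |C| s^2 |h| at most
     [eps]. *)
  have n1 := @nbhs0_le _ V _ e1; have n2 := @nbhs0_le _ V _ e2.
  near=> h.
  have hb : frob h <= s * `|h| by exact: ler_frob_mx_norm.
  have h1 : `|h| <= d / (s + 1) by near: h.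
  have h2 : `|h| <= eps / ((`|C| + 1) * (s ^+ 2 + 1)) by near: h.
  have hd : frob h <= d.
    have := normr_ge0 h; rewrite ler_pdivlMr in h1; [nra|lra].
  have := hF h hd; rewrite !fctE /= -/(L h) (addrC h b) opprD addrA => /le_trans; apply.
  have n0 := normr_ge0 h; have f0 := frob_ge0 h.
  rewrite ler_pdivlMr in h2; last by apply: mulr_gt0; nra.
  have q1 : frob h ^+ 2 <= s ^+ 2 * `|h| ^+ 2.
    by rewrite -exprMn ler_sqr ?nnegrE ?mulr_ge0.
  have q2 : C * frob h ^+ 2 <= `|C| * (s ^+ 2 * `|h| ^+ 2).
    by rewrite (le_trans (ler_norm _))// normrM (ger0_norm (sqr_ge0 _)) ler_wpM2l.
  apply: (le_trans q2); rewrite expr2 !mulrA ler_wpM2r//; apply: le_trans h2.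
  have := sqr_ge0 s; nra.
have dE : 'd F b = LL :> (_ -> _) by exact: diff_unique.
split; first by apply/diff_locallyP; rewrite dE; split.
apply/rowP => j; rewrite !mxE dE /= /L mxE (bigD1 j)//= big1 ?addr0 => [|i /negbTE ij].
  by rewrite !mxE !eqxx mul1r.
by rewrite !mxE ij mul0r.
Unshelve. all: by end_near. Qed.

End Analysis.

(** * Best rank-r approximation *)

Section LowRank.
Variable R : realType.

Lemma orthogonal_unit_vector n r (V : 'M[R]_(n, r)) : (r < n)%N ->
  exists v : 'cV[R]_n, v^T *m v = 1%:M /\ V^T *m v = 0.
Proof.
move=> rn; pose u := nz_row (kermx V).
have u0 : u != 0.
  rewrite nz_row_eq0 -mxrank_eq0 mxrank_ker subn_eq0 -ltnNge.
  exact: leq_ltn_trans (rank_leq_col V) rn.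
have uV : u *m V = 0 by apply/sub_kermxP; exact: nz_row_sub.
exists ((frob u)^-1 *: u^T); split; last first.
  by rewrite -scalemxAr -trmx_mul uV trmx0 scaler0.
rewrite trmx_scale trmxK -scalemxAl -scalemxAr scalerA; apply/matrixP => i j.
rewrite !ord1 [LHS]mxE [RHS]mxE eqxx.
have -> : (u *m u^T) 0 0 = frob u ^+ 2.
  by rewrite -frob_tr frob_sq /dot trmxK /mxtrace big_ord1.
by rewrite -expr2 -exprMn mulVf ?expr1n// frob_eq0.
Qed.

(** Gram-Schmidt for a possibly rank-deficient [f]: a column already in the span of the others is
    replaced by any orthogonal unit vector, so that exactly [r] columns result. *)
Lemma orthonormal_range n r (f : 'M[R]_(n, r)) : (r <= n)%N ->
  exists V : 'M[R]_(n, r), V^T *m V = 1%:M /\ V *m V^T *m f = f.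
Proof.
elim: r f => [|r IH] f rn.
  by exists f; split; [apply/matrixP => -[] | rewrite (thinmx0 f) mulmx0].
rewrite -[f](@hsubmxK _ n 1 r); set f0 := lsubmx _; set f1 := rsubmx _.
have [V [VV Vf]] := IH f1 (ltnW rn).
have [v [vv [Vv vf]]] : exists v : 'cV[R]_n,
    v^T *m v = 1%:M /\ V^T *m v = 0 /\ v *m v^T *m f0 + V *m V^T *m f0 = f0.
  pose g := f0 - V *m V^T *m f0.
  have Vg : V^T *m g = 0 by rewrite /g mulmxBr !mulmxA VV mul1mx subrr.
  have fE : f0 = g + V *m V^T *m f0 by rewrite /g subrK.
  have [g0|g0] := eqVneq g 0.
    have [v [vv Vv]] := orthogonal_unit_vector V rn.
    exists v; split=> //; split=> //.
    rewrite [in RHS]fE g0; congr (_ + _); rewrite fE g0 add0r.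
    by rewrite -!mulmxA (mulmxA v^T) -(trmxK V) -trmx_mul trmxK Vv trmx0 mul0mx mulmx0.
  have gg : g^T *m g = (frob g ^+ 2)%:M.
    apply/matrixP => i j; rewrite !ord1 [RHS]mxE eqxx mulr1n.
    by rewrite frob_sq /dot /mxtrace big_ord1.
  have n0 : frob g != 0 by rewrite frob_eq0.
  exists ((frob g)^-1 *: g); split; [|split].
  - rewrite trmx_scale -scalemxAl -scalemxAr scalerA gg scale_scalar_mx.
    by rewrite -expr2 -exprMn mulVf// expr1n.
  - by rewrite -scalemxAr Vg scaler0.
  - rewrite [in RHS]fE; congr (_ + _); rewrite trmx_scale -scalemxAl -scalemxAr scalerA.
    rewrite -scalemxAl -mulmxA [in X in g *m X]fE mulmxDr gg.
    rewrite !mulmxA -(trmxK V) -trmx_mul trmxK Vg trmx0 !mul0mx addr0.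
    by rewrite mul_mx_scalar scalerA -expr2 -exprMn mulVf// expr1n scale1r.
have vV : v^T *m V = 0 by rewrite -(trmxK V) -trmx_mul Vv trmx0.
(* [1 + r] and [r.+1] are convertible; this form makes the block products apply. *)
suff : exists V' : 'M[R]_(n, 1 + r), V'^T *m V' = 1%:M /\
  V' *m V'^T *m row_mx f0 f1 = row_mx f0 f1 by [].
exists (row_mx v V); split.
  by rewrite tr_row_mx mul_col_row vv VV Vv vV -scalar_mx_block.
rewrite tr_row_mx mul_row_col mul_mx_row !mulmxDl vf; congr row_mx.
by rewrite Vf -Vf !mulmxA -(mulmxA v) vV mulmx0 !mul0mx add0r.
Qed.

(* The profile objective, without its normalisation, as a function of [A = Y - b X]. *)
Definition phi m n r (A : 'M[R]_(m, n)) : R :=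
  inf [set x | exists (l : 'M[R]_(m, r)) (f : 'M[R]_(n, r)), x = frob (A - l *m f^T) ^+ 2].

(** Pythagoras. Minimising the residual over projections is thus maximising |A V|. *)
Lemma frob_sq_proj m n r (A : 'M[R]_(m, n)) (V : 'M[R]_(n, r)) : V^T *m V = 1%:M ->
  frob (A - A *m V *m V^T) ^+ 2 = frob A ^+ 2 - frob (A *m V) ^+ 2.
Proof.
move=> VV; rewrite !frob_sq dotBl !dotBr.
have -> : dot (A *m V *m V^T) (A *m V *m V^T) = dot (A *m V) (A *m V).
  by rewrite dot_mulr trmxK -!mulmxA VV mulmx1.
have -> : dot (A *m V *m V^T) A = dot (A *m V) (A *m V) by rewrite dot_mulr trmxK.
by rewrite dotC dot_mulr trmxK; lra.
Qed.

(** If the range of [V] contains the columns of [f], then [l *m f^T] vanishes against 1 - V V', so A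
    (1 - V V') is the competitor's residual times a contraction. *)
Lemma Stiefel_argmax_le m n r (A : 'M[R]_(m, n)) (U : 'M[R]_(n, r)) :
  Stiefel_argmax A U -> forall (l : 'M[R]_(m, r)) (f : 'M[R]_(n, r)),
  frob (A - A *m U *m U^T) ^+ 2 <= frob (A - l *m f^T) ^+ 2.
Proof.
move=> [UU Umax] l f; have rn : (r <= n)%N by exact: mulmx1_min UU.
have [V [VV Vf]] := orthonormal_range f rn.
rewrite frob_sq_proj//.
apply: (@le_trans _ _ (frob (A - A *m V *m V^T) ^+ 2)).
  by rewrite frob_sq_proj// lerD2l lerN2 ler_sqr ?nnegrE// Umax.
have -> : A - A *m V *m V^T = (A - l *m f^T) *m (1%:M - V *m V^T).
  have lf : l *m f^T *m (V *m V^T) = l *m f^T.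
    by rewrite -mulmxA -[in RHS]Vf 2!trmx_mul trmxK.
  rewrite mulmxBr mulmx1 mulmxBl lf mulmxA; mx_lin.
have [||_ _ hb] := @proj_compl R _ (V *m V^T).
- by rewrite trmx_mul trmxK.
- by rewrite -!mulmxA (mulmxA V^T) VV mul1mx.
by rewrite ler_sqr ?nnegrE// -[leRHS]mul1r; exact: frob_mul_opbr.
Qed.

Lemma phi_le m n r (A : 'M[R]_(m, n)) (l : 'M[R]_(m, r)) (f : 'M[R]_(n, r)) :
  phi r A <= frob (A - l *m f^T) ^+ 2.
Proof.
apply: ge_inf; last by exists l, f.
by exists 0 => _ [l' [f' ->]]; exact: sqr_ge0.
Qed.

Lemma phi_argmax m n r (A : 'M[R]_(m, n)) (U : 'M[R]_(n, r)) :
  Stiefel_argmax A U -> phi r A = frob (A - A *m U *m U^T) ^+ 2.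
Proof.
move=> hU; apply/eqP; rewrite eq_le phi_le/=; apply: lb_le_inf.
  by exists (frob (A - A *m U *m U^T) ^+ 2), (A *m U), U.
by move=> _ [l [f ->]]; exact: Stiefel_argmax_le.
Qed.

(* Replacing the direction [U a] by a unit vector of the plane spanned by [U a]
   and [v] keeps [U] orthonormal. *)
Lemma Stiefel_argmax_rotate m n r (A : 'M[R]_(m, n)) (U : 'M[R]_(n, r))
    (a : 'cV[R]_r) (v : 'cV[R]_n) (s : R) :
  Stiefel_argmax A U -> frob a = 1 -> U^T *m v = 0 ->
  frob (A *m (s *: (U *m a) + v)) ^+ 2 <= frob (A *m U *m a) ^+ 2 * (s ^+ 2 + frob v ^+ 2).
Proof.
move=> [UU Umax] a1 Uv; set x := s *: _ + v; set q := _ + frob v ^+ 2.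
have col_sq k (y : 'cV[R]_k) : y^T *m y = (frob y ^+ 2)%:M.
  apply/matrixP => i j; rewrite !ord1 [RHS]mxE eqxx mulr1n.
  by rewrite frob_sq /dot /mxtrace big_ord1.
have aa : a^T *m a = 1%:M by rewrite col_sq a1 expr1n.
have Ux : U^T *m x = s *: a.
  by rewrite mulmxDr Uv addr0 -scalemxAr mulmxA UU mul1mx.
have xx : frob x ^+ 2 = q.
  rewrite frob_sq /x dotDl !dotDr !dotZl !dotZr.
  rewrite (dotC v) !(dot_mull U a) Uv mulmxA UU mul1mx.
  by rewrite (dotC a 0) dot0l -!frob_sq a1; rewrite /q; lra.
have q0 : 0 <= q by rewrite -xx sqr_ge0.
have [q1|q1] := eqVneq q 0.
  by move/eqP: xx; rewrite q1 expf_eq0/= frob_eq0 => /eqP ->; rewrite mulmx0 frob0 expr0n mulr0.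
have q2 : 0 < q by rewrite lt_def q1.
pose t := (Num.sqrt q)^-1; have t2 : t ^+ 2 * q = 1.
  by rewrite /t exprVn sqr_sqrtr// mulVf.
pose p := 1%:M - a *m a^T; have pa : p *m a = 0.
  by rewrite mulmxBl mul1mx -mulmxA aa mulmx1 subrr.
have pt : p^T = p by rewrite linearB /= trmx1 trmx_mul trmxK.
have pp : p *m p = p by rewrite {2}/p mulmxBr mulmx1 mulmxA pa mul0mx subr0.
have pE : 1%:M = p + a *m a^T by rewrite subrK.
clearbody p x t.
(* [W] agrees with [U] on the complement of [a] and sends [a] to the normalised [x]; it stays
   orthonormal because [x] is orthogonal to [U *m p]. *)
pose W := U *m p + t *: (x *m a^T).
have Wx : (U *m p)^T *m x = 0.
  by rewrite trmx_mul pt -mulmxA Ux -scalemxAr pa scaler0.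
have WW : W^T *m W = 1%:M.
  rewrite /W [X in X *m _]linearD mulmxDl !mulmxDr.
  have -> : (U *m p)^T *m (t *: (x *m a^T)) = 0.
    by rewrite -scalemxAr mulmxA Wx mul0mx scaler0.
  have -> : (t *: (x *m a^T))^T *m (U *m p) = 0.
    rewrite trmx_scale trmx_mul trmxK -scalemxAl -mulmxA.
    by rewrite -[x^T *m _]trmxK trmx_mul trmxK Wx trmx0 mulmx0 scaler0.
  have -> : (U *m p)^T *m (U *m p) = p by rewrite trmx_mul pt mulmxA -(mulmxA p) UU mulmx1.
  have -> : (t *: (x *m a^T))^T *m (t *: (x *m a^T)) = a *m a^T.
    rewrite trmx_scale trmx_mul trmxK -scalemxAl -scalemxAr scalerA mulmxA -(mulmxA a).
    by rewrite col_sq xx mul_mx_scalar -scalemxAl scalerA -expr2 t2 scale1r.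
  by rewrite addr0 add0r -pE.
(* The part of [A *m U] off [a] occurs on both sides and cancels. *)
have := Umax W WW; rewrite -ler_sqr ?nnegrE//.
have tens k (y : 'cV[R]_k) : dot (y *m a^T) (y *m a^T) = dot y y.
  by rewrite dot_mulr trmxK -mulmxA aa mulmx1.
have orth (y : 'cV[R]_m) : dot (A *m U *m p) (y *m a^T) = 0.
  by rewrite dotC dot_mulr trmxK -mulmxA pa mulmx0 dotC dot0l.
have -> : frob (A *m W) ^+ 2 = dot (A *m U *m p) (A *m U *m p) + t ^+ 2 * frob (A *m x) ^+ 2.
  rewrite !frob_sq /W mulmxDr -scalemxAr !mulmxA dotDl !dotDr !dotZl !dotZr.
  by rewrite (dotC (A *m x *m a^T)) orth tens; lra.
have -> : frob (A *m U) ^+ 2 = dot (A *m U *m p) (A *m U *m p) + frob (A *m U *m a) ^+ 2.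
  have AUE : A *m U = A *m U *m p + A *m U *m a *m a^T.
    by rewrite -(mulmxA _ a) -mulmxDr -pE mulmx1.
  transitivity (dot (A *m U *m p + A *m U *m a *m a^T) (A *m U *m p + A *m U *m a *m a^T)).
    by rewrite -AUE frob_sq.
  by rewrite dotDl !dotDr (dotC _ (A *m U *m p)) orth tens frob_sq; lra.
rewrite lerD2l -(ler_pM2r q2) mulrAC t2 mul1r; exact.
Qed.

End LowRank.

(** * Spectral gap *)

Section Gap.
Variable R : realType.

Lemma ler_frob_cols m m' n p s (P : 'M[R]_(m, n)) (B : 'M[R]_(m', n)) (M : 'M[R]_(n, p)) :
  0 <= s -> (forall v : 'cV[R]_n, s * frob (P *m v) <= frob (B *m v)) ->
  s * frob (P *m M) <= frob (B *m M).
Proof.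
move=> s0 h; rewrite -ler_sqr ?nnegrE ?mulr_ge0// exprMn !frob_sq_col mulr_sumr.
by apply: ler_sum => j _; rewrite -exprMn ler_sqr ?nnegrE ?mulr_ge0// !colE -!mulmxA h.
Qed.

Lemma singular_ker k (M : 'M[R]_k) : M \notin unitmx ->
  exists2 b : 'cV[R]_k, b != 0 & M *m b = 0.
Proof.
move=> Mu; pose u := nz_row (kermx M^T).
exists u^T.
  rewrite -(inj_eq (@trmx_inj _ _ _)) trmxK trmx0 nz_row_eq0 -mxrank_eq0 mxrank_ker.
  by rewrite subn_eq0 -ltnNge ltn_neqAle rank_leq_row andbT -/(row_free _) row_free_unit unitmx_tr.
have : u *m M^T = 0 by apply/sub_kermxP; exact: nz_row_sub.
by move=> h; rewrite -[LHS]trmxK trmx_mul trmxK h trmx0.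
Qed.

Lemma frob_orthonormal_mul n r p (U : 'M[R]_(n, r)) (M : 'M[R]_(r, p)) :
  U^T *m U = 1%:M -> frob (U *m M) = frob M.
Proof. by move=> UU; rewrite !frob_dot dot_mull mulmxA UU mul1mx. Qed.

Lemma frob_sq_orthogonal_sum n r p (U : 'M[R]_(n, r)) (a : 'M[R]_(r, p)) (v : 'M[R]_(n, p)) :
  U^T *m U = 1%:M -> U^T *m v = 0 -> frob (U *m a + v) ^+ 2 = frob a ^+ 2 + frob v ^+ 2.
Proof.
move=> UU Uv; rewrite frob_sq dotDl !dotDr (dotC v) !dot_mull mulmxA UU mul1mx Uv.
by rewrite (dotC a 0) dot0l !frob_sq; lra.
Qed.

(** Homogeneous form of the rotation inequality, free of the normalisation of [a]. Below, [s] is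
    taken as a general coefficient, as 1 and as 0. *)
Lemma Stiefel_argmax_exchange m n r (A : 'M[R]_(m, n)) (U : 'M[R]_(n, r))
    (a : 'cV[R]_r) (v : 'cV[R]_n) (s : R) :
  Stiefel_argmax A U -> U^T *m v = 0 ->
  frob (A *m (U *m (s *: a) + v)) ^+ 2 * frob a ^+ 2 <=
  frob (A *m U *m a) ^+ 2 * (frob (s *: a) ^+ 2 + frob v ^+ 2).
Proof.
move=> hU Uv; have [->|a0] := eqVneq a 0.
  by rewrite frob0 expr0n mulr0 mulmx0 frob0 expr0n mul0r.
have n0 : frob a != 0 by rewrite frob_eq0.
have t0 := frob_ge0 a; set t := frob a in n0 t0 *.
pose b := t^-1 *: a; have aE : a = t *: b by rewrite scalerA divff// scale1r.
have b1 : frob b = 1 by rewrite frobZ ger0_norm ?invr_ge0// -/t mulVf.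
have := Stiefel_argmax_rotate (s * t) hU b1 Uv.
rewrite frobZ -/t; clearbody b; rewrite {1 2}aE scalerA -!scalemxAr [frob (t *: _)]frobZ.
rewrite !exprMn !real_normK ?num_real// => h.
by have := ler_wpM2l (sqr_ge0 t) h; lra.
Qed.

(** A truncated singular value decomposition without singular vectors: [Q] projects on the row space
    of the leading part [B], where [B] stretches by at least [s], while the orthogonal rest [D]
    stretches by at most [e]. *)
Definition gap_split m n (B D : 'M[R]_(m, n)) (Q : 'M[R]_n) (s e : R) : Prop :=
  [/\ [/\ Q^T = Q, Q *m Q = Q, B *m Q = B & D *m Q = 0],
      D^T *m B = 0, opb e D &
      forall p (M : 'M[R]_(n, p)), s * frob (Q *m M) <= frob (B *m M)].

Section Argmax.
Variables (m n r : nat) (l : 'M[R]_(m, r)) (f : 'M[R]_(n, r)).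
Variables (A : 'M[R]_(m, n)) (U : 'M[R]_(n, r)) (c eps : R).
Hypothesis fu : f^T *m f \in unitmx.
Hypothesis lower : forall a : 'cV[R]_r, c * frob (f *m a) <= frob (l *m f^T *m (f *m a)).
Hypothesis hU : Stiefel_argmax A U.
Hypothesis eps0 : 0 <= eps.
Hypothesis hE : opb eps (A - l *m f^T).
Hypothesis gap : 2 * eps < c.

Let UU : U^T *m U = 1%:M. Proof. by case: hU. Qed.

(** Each [U *m a] is compared with a vector [x] of the range of [f] whose component along [U] is a
    multiple of it. On [x] the matrix [A] stretches by at least c - eps, and the exchange inequality
    passes this on to [a]. *)
Lemma Stiefel_argmax_lower (a : 'cV[R]_r) : (c - eps) * frob a <= frob (A *m U *m a).
Proof.
have [->|a0] := eqVneq a 0; first by rewrite frob0 mulr0.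
(* When U'f is singular, [x] is taken orthogonal to [U], with [s = 0]. *)
have [b [s [b0 bE]]] : exists (b : 'cV[R]_r) (s : R), b != 0 /\ U^T *m f *m b = s *: a.
  have [Mu|/singular_ker [b b0 Mb]] := boolP (U^T *m f \in unitmx); last first.
    by exists b, 0; rewrite Mb scale0r.
  exists (invmx (U^T *m f) *m a), 1; rewrite mulKVmx// scale1r; split=> //.
  by apply: contra_neq a0 => h; rewrite -[a](mulKVmx Mu) h mulmx0.
pose x := f *m b; pose v := x - U *m (U^T *m x).
have Uv : U^T *m v = 0 by rewrite mulmxBr !mulmxA UU mul1mx subrr.
have xE : x = U *m (s *: a) + v by rewrite -bE -mulmxA addrC subrK.
have x0 : x != 0.
  apply: contra_neq b0 => h; rewrite -[b](mulKmx fu) -mulmxA -/x h.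
  by rewrite !mulmx0.
have := Stiefel_argmax_exchange a s hU Uv.
rewrite -(frob_sq_orthogonal_sum _ UU Uv) -xE.
have h1 : c * frob x <= frob (l *m f^T *m x) by exact: lower.
have h2 : frob (l *m f^T *m x) <= frob (A *m x) + eps * frob x.
  have -> : l *m f^T *m x = A *m x - (A - l *m f^T) *m x by rewrite mulmxBl; mx_lin.
  by rewrite (le_trans (ler_frobB _ _))// lerD2l.
have h3 : (c - eps) * frob x <= frob (A *m x) by lra.
have xp : 0 < frob x by rewrite lt_def frob_eq0 x0 frob_ge0.
have ce : 0 < c - eps by have := gap; have := eps0; lra.
have h4 : ((c - eps) * frob x) ^+ 2 <= frob (A *m x) ^+ 2.
  by rewrite ler_sqr ?nnegrE// mulr_ge0// ltW.
move=> h5; rewrite -ler_sqr ?nnegrE ?mulr_ge0// ?(ltW ce)//.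
have q0 : 0 < frob x ^+ 2 by rewrite exprn_gt0.
rewrite -(ler_pM2r q0); apply: le_trans h5; rewrite exprMn mulrAC -exprMn.
by rewrite ler_wpM2r// sqr_ge0.
Qed.

(** First-order optimality: if the product were nonzero, turning [U *m a] slightly towards [v] or
    [- v] would increase the norm. *)
Lemma Stiefel_argmax_orth (a : 'cV[R]_r) (v : 'cV[R]_n) :
  U^T *m v = 0 -> dot (A *m U *m a) (A *m v) = 0.
Proof.
move=> Uv; set dd := dot _ _.
have [a0|a0] := eqVneq a 0; first by rewrite /dd a0 mulmx0 dot0l.
have ap : 0 < frob a ^+ 2 by rewrite exprn_gt0// lt_def frob_eq0 a0 frob_ge0.
have h t : (2 * t * dd) * frob a ^+ 2 <=
    t ^+ 2 * (frob (A *m U *m a) ^+ 2 * frob v ^+ 2).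
  have Utv : U^T *m (t *: v) = 0 by rewrite -scalemxAr Uv scaler0.
  have := Stiefel_argmax_exchange a 1 hU Utv.
  rewrite scale1r mulmxDr mulmxA -scalemxAr (frob_sq (_ + _)) dotDl !dotDr.
  rewrite !dotZl !dotZr (dotC _ (A *m U *m a)) -/dd -!frob_sq frobZ exprMn.
  rewrite real_normK ?num_real//.
  have : 0 <= (t * frob (A *m v)) ^+ 2 * frob a ^+ 2 by rewrite mulr_ge0 ?sqr_ge0.
  by nra.
set k := _ * frob v ^+ 2 in h.
have k0 : 0 <= k by rewrite mulr_ge0 ?sqr_ge0.
apply/eqP/negP => /negP dd0.
have d2 : 0 < dd ^+ 2 by rewrite exprn_even_gt0.
(* This [t] makes the linear side of [h] exceed the quadratic one; the 1 in the denominator covers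
   [k = 0]. *)
have := h (dd * frob a ^+ 2 / (k + 1)).
have k1 : 0 < k + 1 by lra.
have -> : 2 * (dd * frob a ^+ 2 / (k + 1)) * dd * frob a ^+ 2 =
   (dd ^+ 2 * (frob a ^+ 2) ^+ 2) / (k + 1) ^+ 2 * (2 * (k + 1)).
  by field; rewrite gt_eqF.
have -> : (dd * frob a ^+ 2 / (k + 1)) ^+ 2 * k =
   (dd ^+ 2 * (frob a ^+ 2) ^+ 2) / (k + 1) ^+ 2 * k.
  by field; rewrite gt_eqF.
rewrite ler_pM2l; first by apply/negP; rewrite -ltNge; lra.
by apply: divr_gt0; [apply: mulr_gt0 => //; exact: exprn_gt0|exact: exprn_gt0].
Qed.

(** Adding a suitable vector of the range of [U] to [v] gives a sum killed by [f^T], on which [A]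
    acts by the noise alone. Orthogonality and the exchange inequality then pass the bound on to
    [v]. *)
Lemma Stiefel_argmax_tail (v : 'cV[R]_n) : U^T *m v = 0 -> frob (A *m v) <= eps * frob v.
Proof.
move=> Uv; have [->|v0] := eqVneq v 0; first by rewrite mulmx0 !frob0 mulr0.
have vp : 0 < frob v ^+ 2 by rewrite exprn_gt0// lt_def frob_eq0 v0 frob_ge0.
have EA (x : 'cV[R]_n) : f^T *m x = 0 -> frob (A *m x) <= eps * frob x.
  move=> fx; have -> : A *m x = (A - l *m f^T) *m x.
    by rewrite mulmxBl -mulmxA fx mulmx0 subr0.
  exact: hE.
(* A kernel vector [a] of f'U would give |A U a| <= eps |a|, below the lower bound (c - eps) |a|. *)
have Mu : f^T *m U \in unitmx.
  apply/negPn/negP => /singular_ker [a a0 Ma].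
  have := Stiefel_argmax_lower a; apply/negP; rewrite -ltNge -mulmxA.
  apply: le_lt_trans (EA _ _) _; first by rewrite mulmxA.
  rewrite frob_orthonormal_mul// ltr_pM2r; first by have := gap; have := eps0; lra.
  by rewrite lt_def frob_eq0 a0 frob_ge0.
pose a : 'cV[R]_r := - (invmx (f^T *m U) *m (f^T *m v)).
have fx : f^T *m (U *m a + v) = 0.
  by rewrite mulmxDr mulmxA /a mulmxN mulKVmx// addNr.
have h1 := EA _ fx.
have h2 : frob (A *m (U *m a + v)) ^+ 2 = frob (A *m U *m a) ^+ 2 + frob (A *m v) ^+ 2.
  rewrite (frob_sq (A *m (_ + _))) mulmxDr mulmxA dotDl !dotDr (dotC (A *m v)).
  by rewrite Stiefel_argmax_orth// !frob_sq; lra.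
have h3 := Stiefel_argmax_exchange a 0 hU Uv.
rewrite scale0r mulmx0 add0r frob0 expr0n add0r in h3.
have h4 : frob (A *m (U *m a + v)) ^+ 2 <= (eps * frob (U *m a + v)) ^+ 2.
  by rewrite ler_sqr ?nnegrE ?mulr_ge0.
rewrite exprMn frob_sq_orthogonal_sum// h2 in h4.
rewrite -ler_sqr ?nnegrE ?mulr_ge0// exprMn.
have tp : 0 < frob a ^+ 2 + frob v ^+ 2 by rewrite ltr_wpDl ?sqr_ge0.
rewrite -(ler_pM2r tp); have := ler_wpM2l (ltW vp) h4; lra.
Qed.

Let Q := U *m U^T.
Let B := A *m Q.
Let D := A - B.

Lemma Stiefel_argmax_gap : gap_split B D Q (c - eps) eps.
Proof.
have Qt : Q^T = Q by rewrite trmx_mul trmxK.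
have QQ : Q *m Q = Q by rewrite /Q mulmxA -(mulmxA U) UU mulmx1.
have DE : D = A *m (1%:M - Q) by rewrite mulmxBr mulmx1.
have [_ _ Q1] := proj_compl Qt QQ.
have UQ : U^T *m (1%:M - Q) = 0 by rewrite mulmxBr mulmx1 mulmxA UU mul1mx subrr.
split.
- by split=> //; rewrite ?DE -mulmxA ?QQ// mulmxBl mul1mx QQ subrr mulmx0.
- suff h : D^T *m (A *m U) = 0.
    have -> : B = A *m U *m U^T by rewrite /B mulmxA.
    by rewrite mulmxA h mul0mx.
  apply/matrixP => i j; rewrite [RHS]mxE.
  have -> : (D^T *m (A *m U)) i j = (D^T *m (A *m U) *m delta_mx j 0 : 'cV_n) i 0.
    by rewrite -colE [RHS]mxE.
  suff -> : D^T *m (A *m U) *m (delta_mx j 0 : 'cV_r) = 0 by rewrite mxE.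
  (* The squared norm of this column [w] is the product of a column of [A *m U] with A (1 - Q) w,
     and (1 - Q) w is orthogonal to [U]. *)
  apply/eqP; rewrite -frob_eq0 -sqrf_eq0 frob_sq.
  set w := D^T *m _ *m _; rewrite {1}/w -mulmxA dot_mull trmxK DE -(mulmxA A _ w).
  by rewrite Stiefel_argmax_orth// mulmxA UQ mul0mx.
- move=> v; rewrite DE -mulmxA.
  apply: le_trans (Stiefel_argmax_tail _) _; first by rewrite mulmxA UQ mul0mx.
  by rewrite ler_wpM2l// -[leRHS]mul1r; exact: Q1.
- move=> p M; apply: ler_frob_cols => [|v]; first by have := gap; have := eps0; lra.
  rewrite /B /Q -!mulmxA frob_orthonormal_mul// mulmxA; exact: Stiefel_argmax_lower.
Qed.

End Argmax.

(** The product is of second order. [D1] kills [Q1], so only the part of [Q2] outside [Q1] matters,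
    and the gap bounds it by |B2 - B1| / s; orthogonality of [D1] to [B1] supplies the other
    factor. *)
Lemma gap_split_cross m n (B1 D1 B2 D2 : 'M[R]_(m, n)) (Q1 Q2 : 'M[R]_n) (s e : R) :
  0 <= s -> 0 <= e ->
  gap_split B1 D1 Q1 s e -> gap_split B2 D2 Q2 s e ->
  s * dot D1 B2 <= e * frob (B2 - B1) ^+ 2.
Proof.
move=> s0 e0 [[Q1t Q1Q BQ1 DQ1] DB1 D1e low1] [[Q2t Q2Q BQ2 DQ2] DB2 D2e low2].
have [c1 c2 c3] := proj_compl Q1t Q1Q.
have -> : dot D1 B2 = dot (D1 *m Q2) (B2 - B1).
  rewrite dotBr dot_mulr Q2t BQ2 [X in _ - X]dot_mulr Q2t.
  by rewrite (_ : dot D1 (B1 *m Q2) = 0) ?subr0// /dot mulmxA DB1 mul0mx mxtrace0.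
have -> : D1 *m Q2 = D1 *m ((1%:M - Q1) *m Q2).
  by rewrite mulmxA mulmxBr mulmx1 DQ1 subr0.
have h1 : s * frob ((1%:M - Q1) *m Q2) <= frob (B2 - B1).
  rewrite -frob_tr trmx_mul Q2t c1; apply: le_trans (low2 _ _) _.
  have -> : B2 *m (1%:M - Q1) = (B2 - B1) *m (1%:M - Q1).
    have b10 : B1 *m (1%:M - Q1) = 0 by rewrite mulmxBr mulmx1 BQ1 subrr.
    by rewrite [RHS]mulmxBl b10 subr0.
  by rewrite -[leRHS]mul1r; exact: frob_mul_opbr.
have h2 : frob (D1 *m ((1%:M - Q1) *m Q2)) <= e * frob ((1%:M - Q1) *m Q2).
  exact: frob_mul_opbl.
have h3 := dot_le_frob (D1 *m ((1%:M - Q1) *m Q2)) (B2 - B1).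
have f0 := frob_ge0 (B2 - B1).
apply: (@le_trans _ _ (s * (e * frob ((1%:M - Q1) *m Q2) * frob (B2 - B1)))).
  by rewrite ler_wpM2l// (le_trans h3)// ler_wpM2r.
have := ler_wpM2r f0 (ler_wpM2l e0 h1); lra.
Qed.

(** With F = B2 - B1 and H the change of B + D, |F|^2 = <H,F> + <D1,B2> + <D2,B1>. The cross terms
    total at most (2 e / s) |F|^2, hence half of |F|^2; absorbing them gives the factor 2. *)
Lemma gap_split_lipschitz m n (B1 D1 B2 D2 : 'M[R]_(m, n)) (Q1 Q2 : 'M[R]_n) (s e : R) :
  0 < s -> 0 <= e -> 4 * e <= s ->
  gap_split B1 D1 Q1 s e -> gap_split B2 D2 Q2 s e ->
  frob (B2 - B1) <= 2 * frob (B2 + D2 - (B1 + D1)).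
Proof.
move=> s0 e0 es g1 g2; set H := B2 + D2 - _; set F := B2 - B1.
have x1 := gap_split_cross (ltW s0) e0 g1 g2; have x2 := gap_split_cross (ltW s0) e0 g2 g1.
have o1 : dot D1 B1 = 0 by rewrite /dot; case: g1 => _ -> _ _; rewrite mxtrace0.
have o2 : dot D2 B2 = 0 by rewrite /dot; case: g2 => _ -> _ _; rewrite mxtrace0.
have FE : frob F ^+ 2 = dot H F + dot D1 B2 + dot D2 B1.
  have : dot (F - H) F = dot D1 B2 + dot D2 B1.
    have -> : F - H = D1 - D2 by rewrite /F /H; mx_lin.
    by rewrite dotBl !dotBr o1 o2; lra.
  by rewrite dotBl frob_sq; lra.
rewrite -opprB frobN -/F in x2; rewrite -/F in x1.
have h := dot_le_frob H F; have F0 := frob_ge0 F; have H0 := frob_ge0 H.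
have [F00|Fn] := eqVneq (frob F) 0; first by rewrite F00 mulr_ge0.
have Fp : 0 < frob F by rewrite lt_def Fn.
have : s * frob F ^+ 2 <= s * (frob H * frob F) + 2 * (e * frob F ^+ 2).
  have hH := ler_wpM2l (ltW s0) h.
  have -> : s * frob F ^+ 2 = s * dot H F + s * dot D1 B2 + s * dot D2 B1 by rewrite FE; ring.
  by lra.
have : 4 * e * frob F ^+ 2 <= s * frob F ^+ 2 by rewrite ler_wpM2r ?sqr_ge0.
move=> k1 k2; have : s * frob F * frob F <= s * frob F * (2 * frob H) by lra.
by rewrite ler_pM2l// mulr_gt0.
Qed.

(** The best approximation of each matrix is a competitor for the other, which bounds the increment
    from both sides. With H = A2 - A1, the upper side costs |H|^2; the lower one uses the Lipschitz
    bound and costs 3 |H|^2. The condition 5 eps < c says 4 eps < c - eps. *)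
Lemma phi_expansion m n r (l : 'M[R]_(m, r)) (f : 'M[R]_(n, r)) (c eps : R)
    (A1 A2 : 'M[R]_(m, n)) (U1 U2 : 'M[R]_(n, r)) :
  f^T *m f \in unitmx ->
  (forall a : 'cV[R]_r, c * frob (f *m a) <= frob (l *m f^T *m (f *m a))) ->
  0 <= eps -> 5 * eps < c ->
  Stiefel_argmax A1 U1 -> Stiefel_argmax A2 U2 ->
  opb eps (A1 - l *m f^T) -> opb eps (A2 - l *m f^T) ->
  `|phi r A2 - phi r A1 - 2 * dot (A1 - A1 *m (U1 *m U1^T)) (A2 - A1)|
     <= 3 * frob (A2 - A1) ^+ 2.
Proof.
move=> fu low e0 ec hU1 hU2 hE1 hE2.
have g1 := Stiefel_argmax_gap fu low hU1 e0 hE1 ltac:(lra).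
have g2 := Stiefel_argmax_gap fu low hU2 e0 hE2 ltac:(lra).
have := gap_split_lipschitz _ e0 _ g1 g2.
set B1 := A1 *m (U1 *m U1^T); set B2 := A2 *m (U2 *m U2^T).
rewrite !(addrC _ (_ - _)) !subrK => /(_ ltac:(lra) ltac:(lra)) hF.
set H := A2 - A1 in hF *.
have p1 : phi r A1 = frob (A1 - B1) ^+ 2 by rewrite (phi_argmax hU1) /B1 mulmxA.
have p2 : phi r A2 = frob (A2 - B2) ^+ 2 by rewrite (phi_argmax hU2) /B2 mulmxA.
have u1 : phi r A2 <= frob (A2 - B1) ^+ 2 by rewrite /B1 mulmxA phi_le.
have u2 : phi r A1 <= frob (A1 - B2) ^+ 2 by rewrite /B2 mulmxA phi_le.
have e1 : frob (A2 - B1) ^+ 2 = frob (A1 - B1) ^+ 2 + 2 * dot (A1 - B1) H + frob H ^+ 2.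
  have -> : A2 - B1 = A1 - B1 + H by rewrite /H; mx_lin.
  by rewrite frob_sq dotDl !(dotDr _ (A1 - B1) H) (dotC H (A1 - B1)) !frob_sq; lra.
have e2 : frob (A1 - B2) ^+ 2 = frob (A2 - B2) ^+ 2 - 2 * dot (A2 - B2) H + frob H ^+ 2.
  have -> : A1 - B2 = A2 - B2 - H by rewrite /H; mx_lin.
  by rewrite frob_sq dotBl !(dotBr _ (A2 - B2) H) (dotC H (A2 - B2)) !frob_sq; lra.
have e3 : dot (A2 - B2) H = dot (A1 - B1) H + frob H ^+ 2 - dot (B2 - B1) H.
  have -> : A2 - B2 = A1 - B1 + H - (B2 - B1) by rewrite /H; mx_lin.
  by rewrite dotBl dotDl !frob_sq.
have h := dot_le_frob (B2 - B1) H.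
have h' : dot (B2 - B1) H <= 2 * frob H ^+ 2.
  by rewrite (le_trans h)// expr2 mulrA ler_wpM2r.
rewrite p1 in u2 *; rewrite p2 in u1 *; rewrite ler_norml; apply/andP; split.
  by have := sqr_ge0 (frob H); lra.
by have := sqr_ge0 (frob H); lra.
Qed.

End Gap.

(** * Third-order expansion of the residual *)

Section Expansion.
Variable R : realType.

Lemma frob_mul_lel m n p (a b : R) (A : 'M[R]_(m, n)) (B : 'M[R]_(n, p)) :
  0 <= a -> opb a A -> frob B <= b -> frob (A *m B) <= a * b.
Proof. by move=> a0 hA hB; rewrite (le_trans (frob_mul_opbl _ a0 hA))// ler_wpM2l. Qed.

Lemma frob_mul_ler m n p (a b : R) (A : 'M[R]_(m, n)) (B : 'M[R]_(n, p)) :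
  0 <= b -> frob A <= a -> opb b B -> frob (A *m B) <= a * b.
Proof.
by move=> b0 hA hB; rewrite (le_trans (frob_mul_opbr _ b0 hB))// mulrC ler_wpM2r.
Qed.

Lemma is_MP_tr m n (L : 'M[R]_(m, n)) G : is_MP L G -> is_MP L^T G^T.
Proof.
move=> [h1 h2 h3 h4]; split.
- by rewrite -!trmx_mul mulmxA h1.
- by rewrite -!trmx_mul mulmxA h2.
- by rewrite -trmx_mul h4.
- by rewrite -trmx_mul h3.
Qed.

Lemma is_MP_proj m n (L : 'M[R]_(m, n)) G : is_MP L G ->
  let M := 1%:M - L *m G in let Mf := 1%:M - G *m L in
  [/\ M^T = M, Mf^T = Mf, opb 1 M & opb 1 Mf] /\
  [/\ M *m L = 0, L *m Mf = 0, M *m M = M & Mf *m Mf = Mf].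
Proof.
move=> [h1 h2 h3 h4] M Mf.
have p1 : L *m G *m (L *m G) = L *m G by rewrite mulmxA h1.
have p2 : G *m L *m (G *m L) = G *m L by rewrite mulmxA h2.
have [a1 a2 a3] := proj_compl h3 p1; have [b1 b2 b3] := proj_compl h4 p2.
by split; split=> //; rewrite ?mulmxBl ?mulmxBr ?mul1mx ?mulmx1 ?mulmxA ?h1 subrr.
Qed.

Section Sides.
Variables (m n : nat) (L : 'M[R]_(m, n)) (G : 'M[R]_(n, m)) (E D : 'M[R]_(m, n)).
Variables (x g : R).
Hypothesis MP : is_MP L G.
Hypothesis LD : L^T *m D = - ((E - D)^T *m D).
Hypothesis DL : D *m L^T = - (D *m (E - D)^T).
Hypothesis x0 : 0 <= x.
Hypothesis hE : opb x E.
Hypothesis hD : opb x D.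
Hypothesis hG : frob G <= g.
Let M := 1%:M - L *m G.
Let Mf := 1%:M - G *m L.
Let F := E - D.

Let g0 : 0 <= g. Proof. exact: le_trans hG. Qed.
Let hF : opb (2 * x) F.
Proof. by apply: opbW (opbB hE hD); have := x0; lra. Qed.
Let x20 : 0 <= 2 * x. Proof. by rewrite mulr_ge0. Qed.
Let hFt : opb (2 * x) F^T. Proof. exact: opb_tr. Qed.
Let hGt : frob G^T <= g. Proof. by rewrite frob_tr. Qed.

(** Being symmetric, [L *m G] equals G' L', and the orthogonality relation trades [L] for a noise
    factor: this component of [D] is already of second order. *)
Lemma proj_left_resid : L *m G *m D = - (G^T *m F^T *m D).
Proof.
case: MP => _ _ <- _.
by rewrite trmx_mul -(mulmxA _ L^T) LD mulmxN mulmxA.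
Qed.

Lemma proj_right_resid : D *m (G *m L) = - (D *m F^T *m G^T).
Proof. by case: MP => _ _ _ <-; rewrite trmx_mul mulmxA DL mulNmx. Qed.

Lemma frob_proj_left_resid : frob (L *m G *m D) <= 2 * g * x ^+ 2.
Proof.
rewrite proj_left_resid frobN.
have := frob_mul_ler x0 (frob_mul_ler x20 hGt hFt) hD; lra.
Qed.

(** Writing G = G L G brings in the projection [G *m L], so that one noise factor next to [G]
    becomes two. *)
Lemma frob_resid_pinv : frob (D *m G) <= 2 * g ^+ 2 * x ^+ 2.
Proof.
have -> : D *m G = - (D *m F^T *m G^T *m G).
  by case: (MP) => _ h2 _ _; rewrite -[in LHS]h2 mulmxA proj_right_resid mulNmx.
rewrite frobN -!mulmxA.
have h : frob (G^T *m G) <= g * g by rewrite (le_trans (frob_mul _ _))// ler_pM.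
have := frob_mul_lel x0 hD (frob_mul_lel x20 hFt h); lra.
Qed.

Lemma frob_pinv_resid : frob (G *m D) <= 2 * g ^+ 2 * x ^+ 2.
Proof.
have -> : G *m D = - (G *m G^T *m F^T *m D).
  by case: (MP) => _ h2 _ _; rewrite -[in LHS]h2 -(mulmxA G) -(mulmxA G) proj_left_resid mulmxN !mulmxA.
rewrite frobN.
have h : frob (G *m G^T) <= g * g by rewrite (le_trans (frob_mul _ _))// ler_pM.
have := frob_mul_ler x0 (frob_mul_ler x20 h hFt) hD; lra.
Qed.

(** [proj_left_resid] gives - G' F' (L G D + M D) Mf, whose first part is of third order. In the
    second, passing from D and F to E costs M F Mf and D G, both of second order, next to a noise
    factor; 22 = 4 + 16 + 2. *)
Lemma resid_left_expansion : frob (M *m F *m Mf) <= 8 * g * x ^+ 2 ->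
  frob (L *m G *m D *m Mf + G^T *m E^T *m M *m E *m Mf) <= 22 * g ^+ 2 * x ^+ 3.
Proof.
move=> hW; have [[Mt Mft M1 Mf1] [ML LMf MM MfMf]] := is_MP_proj MP.
rewrite -/M -/Mf in Mt Mft M1 Mf1 ML LMf MM MfMf.
have DE : D = L *m G *m D + M *m D by rewrite mulmxBl mul1mx; mx_lin.
have -> : L *m G *m D *m Mf + G^T *m E^T *m M *m E *m Mf =
    - (G^T *m F^T *m (L *m G *m D) *m Mf) + G^T *m F^T *m (M *m F *m Mf)
    + (D *m G)^T *m (M *m E *m Mf).
  have e1 : L *m G *m D *m Mf =
      - (G^T *m F^T *m (L *m G *m D) *m Mf) - G^T *m F^T *m (M *m D *m Mf).
    rewrite {1}proj_left_resid mulNmx {1}DE mulmxDr mulmxDl opprD.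
    by congr (_ - _); rewrite !mulmxA.
  have e2 : M *m D *m Mf = M *m E *m Mf - M *m F *m Mf.
    by rewrite /F (mulmxBr M) (mulmxBl _ _ Mf); mx_lin.
  have e3 : G^T *m E^T *m M *m E *m Mf =
      (D *m G)^T *m (M *m E *m Mf) + G^T *m F^T *m (M *m E *m Mf).
    rewrite trmx_mul -mulmxDl -mulmxDr -linearD /=.
    by rewrite (_ : D + F = E) ?mulmxA// /F; mx_lin.
  by rewrite e1 e2 e3 (mulmxBr (G^T *m F^T)); mx_lin.
have t1 : frob (G^T *m F^T *m (L *m G *m D) *m Mf) <= 4 * g ^+ 2 * x ^+ 3.
  apply: (le_trans (frob_mul_opbr _ ler01 Mf1)); rewrite mul1r.
  apply: le_trans (frob_mul _ _) _.
  apply: le_trans (ler_pM _ _ (frob_mul_ler x20 hGt hFt) frob_proj_left_resid) _ => //.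
  by lra.
have t2 : frob (G^T *m F^T *m (M *m F *m Mf)) <= 16 * g ^+ 2 * x ^+ 3.
  apply: le_trans (frob_mul _ _) _.
  by apply: le_trans (ler_pM _ _ (frob_mul_ler x20 hGt hFt) hW) _ => //; lra.
have t3 : frob ((D *m G)^T *m (M *m E *m Mf)) <= 2 * g ^+ 2 * x ^+ 3.
  have hME : opb (1 * x * 1) (M *m E *m Mf).
    by apply: opbM => //; [rewrite mul1r|exact: opbM].
  rewrite mulr1 mul1r in hME.
  have dg : frob (D *m G)^T <= 2 * g ^+ 2 * x ^+ 2 by rewrite frob_tr frob_resid_pinv.
  by have := frob_mul_ler x0 dg hME; lra.
apply: le_trans (ler_frobD _ _) _; apply: le_trans (lerD (ler_frobD _ _) (lexx _)) _.
by rewrite frobN; lra.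
Qed.

End Sides.

(** Second-order part of the residual, up to sign. It is bilinear so that pure noise, which makes up
    C^(2), can be separated from the terms containing regressors. *)
Definition quad_term m n (L : 'M[R]_(m, n)) (G : 'M[R]_(n, m)) (E1 E2 : 'M[R]_(m, n)) :=
  let M := 1%:M - L *m G in let Mf := 1%:M - G *m L in
  M *m E1 *m G *m E2 *m Mf + G^T *m E1^T *m M *m E2 *m Mf + M *m E1 *m Mf *m E2^T *m G^T.

Lemma frob_quad_term m n (L : 'M[R]_(m, n)) (G : 'M[R]_(n, m)) (E1 E2 : 'M[R]_(m, n)) (a b g : R) :
  is_MP L G -> 0 <= a -> 0 <= b -> opb a E1 -> opb b E2 -> frob G <= g ->
  frob (quad_term L G E1 E2) <= 3 * g * a * b.
Proof.
move=> MP a0 b0 h1 h2 hG; have [[_ _ M1 Mf1] _] := is_MP_proj MP.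
have hGt : frob G^T <= g by rewrite frob_tr.
have l1 : (0 : R) <= 1 by [].
have h1t := opb_tr a0 h1; have h2t := opb_tr b0 h2.
have t1 := frob_mul_ler l1 (frob_mul_ler b0
  (frob_mul_lel (mulr_ge0 l1 a0) (opbM l1 M1 h1) hG) h2) Mf1.
have t2 := frob_mul_ler l1 (frob_mul_ler b0 (frob_mul_ler l1 (frob_mul_ler a0 hGt h1t) M1) h2) Mf1.
have t3 := frob_mul_lel (mulr_ge0 (mulr_ge0 (mulr_ge0 l1 a0) l1) b0)
  (opbM (mulr_ge0 (mulr_ge0 l1 a0) l1) (opbM (mulr_ge0 l1 a0) (opbM l1 M1 h1) Mf1) h2t) hGt.
apply: le_trans (ler_frobD _ _) _; apply: le_trans (lerD (ler_frobD _ _) (lexx _)) _.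
by lra.
Qed.

Lemma quad_term_split m n (L : 'M[R]_(m, n)) (G : 'M[R]_(n, m)) (E1 E2 : 'M[R]_(m, n)) :
  quad_term L G (E1 + E2) (E1 + E2) =
  quad_term L G E1 E1 + quad_term L G E1 E2 + quad_term L G E2 E1 + quad_term L G E2 E2.
Proof.
rewrite /quad_term !(raddfD (@trmx R m n)) /=.
by rewrite !(mulmxDl, mulmxDr _ E1 E2, mulmxDr _ E1^T E2^T); mx_lin.
Qed.

Section Main.
Variables (m n : nat) (L : 'M[R]_(m, n)) (G : 'M[R]_(n, m)) (E B D : 'M[R]_(m, n)).
Variables (Q : 'M[R]_n) (x s g : R).
Hypothesis MP : is_MP L G.
Hypothesis hS : gap_split B D Q s x.
Hypothesis hA : B + D = L + E.
Hypothesis x0 : 0 <= x.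
Hypothesis s0 : 0 < s.
Hypothesis xs : 4 * x <= s.
Hypothesis hE : opb x E.
Hypothesis hG : frob G <= g.
Let M := 1%:M - L *m G.
Let Mf := 1%:M - G *m L.
Let F := E - D.

Let BE : B = L + F. Proof. by rewrite /F addrA -hA addrK. Qed.

Let LD : L^T *m D = - (F^T *m D).
Proof.
case: hS => _ h _ _; apply/eqP; rewrite -addr_eq0 -mulmxDl -linearD /= -BE.
by rewrite -[_ *m D]trmxK trmx_mul trmxK h trmx0.
Qed.

Let DL : D *m L^T = - (D *m F^T).
Proof.
case: hS => -[Qt _ BQ DQ] _ _ _; apply/eqP; rewrite -addr_eq0 -mulmxDr -linearD /= -BE.
by rewrite -BQ trmx_mul Qt mulmxA DQ mul0mx.
Qed.

(* [M F Mf - M F G F Mf] is a Schur complement: it equals [M B (1 - G B) Mf],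
   and on the range of [B] the component [M B] is small relative to [B] itself. *)
Lemma schur_complement_bound :
  frob (M *m F *m Mf - M *m F *m G *m F *m Mf) <= 16 * g / s * x ^+ 3.
Proof.
have [[Mt Mft M1 Mf1] [ML LMf MM MfMf]] := is_MP_proj MP.
rewrite -/M -/Mf in Mt Mft M1 Mf1 ML LMf MM MfMf.
case: hS => -[Qt QQ BQ DQ] _ hD low.
have hF : opb (2 * x) F by apply: opbW (opbB hE hD); lra.
have x20 : 0 <= 2 * x by rewrite mulr_ge0.
have MB : M *m B = M *m F by rewrite BE mulmxDr ML add0r.
have BMf : B *m Mf = F *m Mf by rewrite BE mulmxDl LMf add0r.
set Z := _ - _.
pose w := (1%:M - G *m B) *m Mf.
have wE : w = Mf - G *m B *m Mf by rewrite /w (mulmxBl 1%:M (G *m B) Mf) mul1mx.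
have ZE : Z = M *m B *m w.
  rewrite wE (mulmxBr (M *m B)) MB; congr (_ - _).
  by rewrite -[G *m B *m Mf]mulmxA BMf !mulmxA.
have ZF : Z = M *m F *m (Q *m w) by rewrite -MB mulmxA -(mulmxA M B) BQ.
have LGL : L *m G *m L = L by case: MP.
have Bw : B *m w = F *m Mf - B *m (G *m (F *m Mf)).
  by rewrite wE (mulmxBr B) -(mulmxA G B) BMf.
have PBw : L *m G *m (B *m w) = - (L *m G *m (F *m G *m F *m Mf)).
  rewrite Bw BE (mulmxDl L F) (mulmxBr (L *m G)) (mulmxDr (L *m G)) !mulmxA LGL.
  by mx_lin.
have LG1 : opb 1 (L *m G).
  by case: MP => _ _ Pt _; apply: opb_proj => //; rewrite mulmxA LGL.
have l1 : (0 : R) <= 1 by [].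
have t1 : frob (B *m w) <= frob Z + 4 * g * x ^+ 2.
  have -> : B *m w = Z + L *m G *m (B *m w).
    by rewrite ZE -mulmxA /M (mulmxBl 1%:M) mul1mx subrK.
  apply: le_trans (ler_frobD _ _) _; rewrite lerD2l PBw frobN.
  apply: le_trans (frob_mul_opbl _ l1 LG1) _; rewrite mul1r.
  apply: le_trans (frob_mul_opbr _ l1 Mf1) _; rewrite mul1r.
  by have := frob_mul_ler x20 (frob_mul_lel x20 hF hG) hF; lra.
have t2 : frob Z <= 2 * x * frob (Q *m w).
  rewrite ZF; apply: le_trans (frob_mul_opbl _ _ (opbM l1 M1 hF)) _; rewrite ?mul1r//.
have t3 := low _ w.
(* |Z| reappears on the right with coefficient 2 x <= s / 2 and is absorbed. *)
have t4 : s * frob Z <= 2 * x * (frob Z + 4 * g * x ^+ 2).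
  have := ler_wpM2l (ltW s0) t2; have := ler_wpM2l x20 (le_trans t3 t1); lra.
have t5 : 4 * x * frob Z <= s * frob Z by rewrite ler_wpM2r.
rewrite mulrAC ler_pdivlMr//; lra.
Qed.

(** The projections [L *m G] and [G *m L] cut [D] into four blocks. The Schur complement contributes
    16 g / s; 54 = 22 + 22 + 6 + 4 comes from the two mixed blocks, the passage from F to E in M F G
    F Mf, and the block L G D G L. *)
Lemma resid_expansion :
  frob (D - (M *m E *m Mf - quad_term L G E E)) <= (16 * g / s + 54 * g ^+ 2) * x ^+ 3.
Proof.
have [[Mt Mft M1 Mf1] [ML LMf MM MfMf]] := is_MP_proj MP.
rewrite -/M -/Mf in Mt Mft M1 Mf1 ML LMf MM MfMf.
have [_ _ hD _] := hS.
have l1 : (0 : R) <= 1 by [].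
have g0 : 0 <= g by exact: le_trans hG.
have x20 : 0 <= 2 * x by rewrite mulr_ge0.
have hF : opb (2 * x) F by apply: opbW (opbB hE hD); lra.
have hZ := schur_complement_bound.
have hGt : frob G^T <= g by rewrite frob_tr.
set W := M *m F *m Mf in hZ *.
have hMFGFMf : frob (M *m F *m G *m F *m Mf) <= 4 * g * x ^+ 2.
  apply: le_trans (frob_mul_opbr _ l1 Mf1) _; rewrite mul1r -!mulmxA.
  apply: le_trans (frob_mul_opbl _ l1 M1) _; rewrite mul1r.
  by have := frob_mul_lel x20 hF (frob_mul_ler x20 hG hF); lra.
have hZ' : 16 * g / s * x ^+ 3 <= 4 * g * x ^+ 2.
  rewrite mulrAC ler_pdivrMr//.
  by have := ler_wpM2l (mulr_ge0 g0 (sqr_ge0 x)) xs; lra.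
have hW : frob W <= 8 * g * x ^+ 2.
  have -> : W = (W - M *m F *m G *m F *m Mf) + M *m F *m G *m F *m Mf by rewrite subrK.
  by apply: le_trans (ler_frobD _ _) _; lra.
have e1 := resid_left_expansion MP LD DL x0 hE hD hG hW.
have Ft : E^T - D^T = F^T by rewrite /F raddfB.
(* This mixed block is the other one for the transposed data. *)
have e2 : frob (M *m D *m (G *m L) + M *m E *m Mf *m E^T *m G^T) <= 22 * g ^+ 2 * x ^+ 3.
  have trM : 1%:M - G^T *m L^T = M by rewrite -trmx_mul -Mt raddfB /= trmx1.
  have trMf : 1%:M - L^T *m G^T = Mf by rewrite -trmx_mul -Mft raddfB /= trmx1.
  have LDt : L^T^T *m D^T = - ((E^T - D^T)^T *m D^T).
    by rewrite -trmx_mul DL Ft -trmx_mul raddfN.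
  have DLt : D^T *m L^T^T = - (D^T *m (E^T - D^T)^T).
    by rewrite -trmx_mul LD Ft -trmx_mul raddfN.
  have := resid_left_expansion (is_MP_tr MP) LDt DLt x0 (opb_tr x0 hE) (opb_tr x0 hD) hGt.
  rewrite trM trMf Ft => /(_ _)/le_trans; move=> h; rewrite -frob_tr.
  have -> : (M *m D *m (G *m L) + M *m E *m Mf *m E^T *m G^T)^T =
      L^T *m G^T *m D^T *m M + G^T^T *m E^T^T *m Mf *m E^T *m M.
    by rewrite raddfD /= !trmx_mul Mt Mft !mulmxA.
  apply: h; last exact: lexx.
  by rewrite -[M in X in X <= _]Mt -[X in X *m _ *m _]Mft -mulmxA -!trmx_mul frob_tr.
have e3 : frob (M *m F *m G *m F *m Mf - M *m E *m G *m E *m Mf) <= 6 * g ^+ 2 * x ^+ 3.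
  have -> : M *m F *m G *m F *m Mf - M *m E *m G *m E *m Mf =
      - (M *m (D *m G) *m F *m Mf) - M *m E *m (G *m D) *m Mf.
    have f1 : M *m F *m G *m F = M *m E *m G *m F - M *m D *m G *m F.
      by rewrite -(mulmxBl _ _ F) -(mulmxBl _ _ G) -mulmxBr.
    have f2 : M *m E *m G *m F = M *m E *m G *m E - M *m E *m G *m D by rewrite -mulmxBr.
    by rewrite f1 f2 !(mulmxBl _ _ Mf) !mulmxA; mx_lin.
  apply: le_trans (ler_frobB _ _) _; rewrite frobN.
  have u1 : frob (M *m (D *m G) *m F *m Mf) <= 4 * g ^+ 2 * x ^+ 3.
    have := frob_mul_ler l1 (frob_mul_ler x20 (frob_mul_lel l1 M1
      (frob_resid_pinv MP DL x0 hE hD hG)) hF) Mf1; lra.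
  have u2 : frob (M *m E *m (G *m D) *m Mf) <= 2 * g ^+ 2 * x ^+ 3.
    have := frob_mul_ler l1 (frob_mul_lel (mulr_ge0 l1 x0) (opbM l1 M1 hE)
      (frob_pinv_resid MP LD x0 hE hD hG)) Mf1; lra.
  by lra.
have e4 : frob (L *m G *m D *m (G *m L)) <= 4 * g ^+ 2 * x ^+ 3.
  rewrite (proj_left_resid MP LD) mulNmx frobN -(mulmxA _ D) (proj_right_resid MP DL) mulmxN frobN.
  apply: le_trans (frob_mul _ _) _.
  have hFt := opb_tr x20 hF.
  have u1 := frob_mul_ler x20 hGt hFt.
  have u2 := frob_mul_lel (mulr_ge0 x0 x20) (opbM x0 hD hFt) hGt.
  by apply: le_trans (ler_pM _ _ u1 u2) _ => //; lra.
have -> : D - (M *m E *m Mf - quad_term L G E E) =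
  - (W - M *m F *m G *m F *m Mf)
  - (M *m F *m G *m F *m Mf - M *m E *m G *m E *m Mf)
  + (L *m G *m D *m Mf + G^T *m E^T *m M *m E *m Mf)
  + (M *m D *m (G *m L) + M *m E *m Mf *m E^T *m G^T)
  + L *m G *m D *m (G *m L).
  have -> : quad_term L G E E = M *m E *m G *m E *m Mf + G^T *m E^T *m M *m E *m Mf
    + M *m E *m Mf *m E^T *m G^T by [].
  have d1 : D = L *m G *m D + M *m D by rewrite (mulmxBl 1%:M) mul1mx; mx_lin.
  have d2 (C : 'M[R]_(m, n)) : C = C *m (G *m L) + C *m Mf.
    by rewrite (mulmxBr C) mulmx1; mx_lin.
  have d3 : M *m D *m Mf = M *m E *m Mf - W.
    by rewrite /W /F (mulmxBr M) (mulmxBl _ _ Mf); mx_lin.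
  by rewrite {1}d1 {1}(d2 (L *m G *m D)) {1}(d2 (M *m D)) d3; mx_lin.
have tri (C1 C2 C3 C4 C5 : 'M[R]_(m, n)) :
    frob (- C1 - C2 + C3 + C4 + C5) <= frob C1 + frob C2 + frob C3 + frob C4 + frob C5.
  do 3![rewrite (le_trans (ler_frobD _ _))// lerD2r].
  by rewrite (le_trans (ler_frobB _ _))// frobN.
by apply: le_trans (tri _ _ _ _ _) _; lra.
Qed.

End Main.
End Expansion.

(** * The score function *)

Section MoorePenrose.
Variable R : realType.

Lemma MPinv_unit r (S : 'M[R]_r) : S \in unitmx -> MPinv S = invmx S.
Proof.
move=> Su; have MP : is_MP S (invmx S).
  by split; rewrite ?mulmxV ?mulVmx ?mul1mx ?trmx1.
have [h _ _ _] := xgetPex (0 : 'M[R]_r) (ex_intro (is_MP S) _ MP).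
rewrite -/(MPinv S) in h.
have SB : S *m MPinv S = 1%:M by rewrite -[LHS]mulmx1 -(mulmxV Su) mulmxA h.
by rewrite -[LHS](mulKmx Su) SB mulmx1.
Qed.

Lemma gram_lower m r (A : 'M[R]_(m, r)) (c : R) : (0 < m)%N ->
  (forall v : 'rV[R]_r, c * frob v ^+ 2 <= (v *m (m%:R^-1 *: (A^T *m A)) *m v^T) 0 0) ->
  forall a : 'cV[R]_r, m%:R * c * frob a ^+ 2 <= frob (A *m a) ^+ 2.
Proof.
move=> m0 h a; have m1 : 0 < m%:R :> R by rewrite ltr0n.
have := h a^T; rewrite trmxK -scalemxAr -scalemxAl frob_tr scalemx_entry.
have -> : (a^T *m (A^T *m A) *m a) 0 0 = frob (A *m a) ^+ 2.
  by rewrite frob_sq /dot trmx_mul /mxtrace big_ord1 !mulmxA.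
by rewrite -(ler_pM2l m1) !mulrA divff ?gt_eqF// mul1r.
Qed.

Lemma gram_unit m r (A : 'M[R]_(m, r)) (c : R) : 0 < c ->
  (forall a : 'cV[R]_r, c * frob a ^+ 2 <= frob (A *m a) ^+ 2) -> A^T *m A \in unitmx.
Proof.
move=> c0 h; apply/negPn/negP => /singular_ker [a a0 Aa].
have := h a; rewrite (frob_sq (A *m a)) dot_mull mulmxA Aa dotC dot0l; apply/negP.
by rewrite -ltNge mulr_gt0// exprn_gt0// lt_def frob_eq0 a0 frob_ge0.
Qed.

(** |A a|^2 = <a, A'A a> is at most |a| |A'A a|, while |a| is at most |A a| / sqrt c. *)
Lemma gram_adjoint_lower m r (A : 'M[R]_(m, r)) (c : R) : 0 < c ->
  (forall a : 'cV[R]_r, c * frob a ^+ 2 <= frob (A *m a) ^+ 2) ->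
  forall a : 'cV[R]_r, c * frob (A *m a) ^+ 2 <= frob (A^T *m (A *m a)) ^+ 2.
Proof.
move=> c0 h a; have [->|y0] := eqVneq (A *m a) 0.
  by rewrite mulmx0 !frob0 expr0n mulr0.
have yp : 0 < frob (A *m a) ^+ 2 by rewrite exprn_gt0// lt_def frob_eq0 y0 frob_ge0.
have h1 : frob (A *m a) ^+ 2 <= frob a * frob (A^T *m (A *m a)).
  by rewrite frob_sq dot_mull dot_le_frob.
have h2 : (frob (A *m a) ^+ 2) ^+ 2 <= frob a ^+ 2 * frob (A^T *m (A *m a)) ^+ 2.
  by rewrite -exprMn ler_sqr ?nnegrE ?mulr_ge0 ?sqr_ge0.
rewrite -(ler_pM2l yp); apply: (@le_trans _ _ (c * (frob a ^+ 2 * frob (A^T *m (A *m a)) ^+ 2))).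
  by have := ler_wpM2l (ltW c0) h2; lra.
by have := ler_wpM2r (sqr_ge0 (frob (A^T *m (A *m a)))) (h a); lra.
Qed.

Section FactorStructure.
Variables (m n r : nat) (lam : 'M[R]_(m, r)) (f : 'M[R]_(n, r)) (s : R).
Hypothesis s0 : 0 < s.
Hypothesis lamu : lam^T *m lam \in unitmx.
Hypothesis fu : f^T *m f \in unitmx.

(** The pseudo-inverse of the signal scaled by 1/s, explicit because both factors have full column
    rank. The same product of inverses stands in [Cvec]. *)
Definition factor_pinv : 'M[R]_(n, m) :=
  s *: (f *m invmx (f^T *m f) *m invmx (lam^T *m lam) *m lam^T).

Let L := (s^-1 *: lam) *m f^T.
Let G := factor_pinv.

Lemma factor_pinvr : L *m G = lam *m invmx (lam^T *m lam) *m lam^T.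
Proof.
rewrite /L /G /factor_pinv -!scalemxAl -scalemxAr scalerA mulVf ?gt_eqF// scale1r.
by rewrite !mulmxA -(mulmxA lam f^T) -(mulmxA lam (f^T *m f)) mulmxV// mulmx1.
Qed.

Lemma factor_pinvl : G *m L = f *m invmx (f^T *m f) *m f^T.
Proof.
rewrite /L /G /factor_pinv -!scalemxAl -scalemxAr scalerA mulfV ?gt_eqF// scale1r.
rewrite !mulmxA -(mulmxA _ lam^T lam) -(mulmxA (f *m _)) mulVmx//.
by rewrite mulmx1.
Qed.

Lemma factor_pinv_MP : is_MP L G.
Proof.
have sym k (S : 'M[R]_k) : S^T = S -> (invmx S)^T = invmx S by rewrite trmx_inv => ->.
have lt : (lam^T *m lam)^T = lam^T *m lam by rewrite trmx_mul trmxK.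
have ft : (f^T *m f)^T = f^T *m f by rewrite trmx_mul trmxK.
split.
- rewrite factor_pinvr /L -!scalemxAl -scalemxAr; congr (_ *: _).
  by rewrite !mulmxA -(mulmxA _ lam^T lam) -(mulmxA lam) mulVmx// mulmx1.
- rewrite factor_pinvl /G /factor_pinv -scalemxAr; congr (_ *: _).
  by rewrite !mulmxA -(mulmxA _ f^T f) -(mulmxA f) mulVmx// mulmx1.
- by rewrite factor_pinvr !trmx_mul trmxK sym// mulmxA.
- by rewrite factor_pinvl !trmx_mul trmxK sym// mulmxA.
Qed.

Lemma Mproj_left : Mproj lam = 1%:M - L *m G.
Proof. by rewrite factor_pinvr /Mproj MPinv_unit. Qed.

Lemma Mproj_right : Mproj f = 1%:M - G *m L.
Proof. by rewrite factor_pinvl /Mproj MPinv_unit. Qed.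

(** [L *m G] is a projection of trace [r], so its Frobenius norm is sqrt r; and [G] takes values in
    the range of [f], which [L] stretches by at least [c]. *)
Lemma frob_factor_pinv c : 0 < c ->
  (forall a : 'cV[R]_r, c * frob (f *m a) <= frob (L *m (f *m a))) ->
  frob G <= Num.sqrt r%:R / c.
Proof.
move=> c0 low; rewrite ler_pdivlMr// mulrC.
have GE : G = f *m (s *: (invmx (f^T *m f) *m invmx (lam^T *m lam) *m lam^T)).
  by rewrite /G /factor_pinv -scalemxAr !mulmxA.
have h : c * frob G <= frob (L *m G).
  rewrite GE mulmxA; apply: ler_frob_cols (ltW c0) _ => a.
  by rewrite -mulmxA low.
apply: (le_trans h); rewrite -ler_sqr ?nnegrE ?sqrtr_ge0// frob_sq sqr_sqrtr ?ler0n//.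
rewrite /dot; case: factor_pinv_MP => h1 _ -> _; rewrite mulmxA h1 factor_pinvr.
by rewrite -mulmxA mxtrace_mulC -mulmxA mulVmx// mxtrace1.
Qed.

End FactorStructure.
End MoorePenrose.

(** * The coefficients [W] and [C], and the gradient of the remainder *)

Section Score.
Variable R : realType.
Variables (m n K r : nat) (X : 'I_K -> 'M[R]_(m, n)) (lam : 'M[R]_(m, r))
  (f : 'M[R]_(n, r)) (e : 'M[R]_(m, n)) (b0 : 'rV[R]_K).
Variables (c1 c2 CX ee : R).
Hypotheses (m0 : (0 < m)%N) (n0 : (0 < n)%N) (c10 : 0 < c1) (c20 : 0 < c2).
Let s := Num.sqrt (m * n)%:R : R.
Hypothesis Hlam : forall v : 'rV[R]_r,
  c1 * frob v ^+ 2 <= (v *m (m%:R^-1 *: (lam^T *m lam)) *m v^T) 0 0.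
Hypothesis Hf : forall v : 'rV[R]_r,
  c2 * frob v ^+ 2 <= (v *m (n%:R^-1 *: (f^T *m f)) *m v^T) 0 0.
Hypothesis CX0 : 0 <= CX.
Hypothesis HX : forall k, frob (X k) <= CX * s.
Hypothesis ee0 : 0 <= ee.
Hypothesis He : spec e <= ee * s.

Let c := Num.sqrt (c1 * c2).
Let g := Num.sqrt r%:R / c.
Let L := (s^-1 *: lam) *m f^T.
Let G := factor_pinv lam f s.
Let Xt k := s^-1 *: X k.
Let et := s^-1 *: e.
Let Y := Ymodel b0 X lam f e.
Let A b := s^-1 *: (Y - bdot b X).
Let M := 1%:M - L *m G.
Let Mf := 1%:M - G *m L.

Let m1 : 0 < m%:R :> R. Proof. by rewrite ltr0n. Qed.
Let n1 : 0 < n%:R :> R. Proof. by rewrite ltr0n. Qed.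
Let s2 : s ^+ 2 = m%:R * n%:R. Proof. by rewrite sqr_sqrtr ?ler0n// natrM. Qed.
Let s0 : 0 < s. Proof. by rewrite sqrtr_gt0 ltr0n muln_gt0 m0. Qed.
Let c0 : 0 < c. Proof. by rewrite sqrtr_gt0 mulr_gt0. Qed.
Let lamu : lam^T *m lam \in unitmx.
Proof. by apply: gram_unit (mulr_gt0 m1 c10) _; exact: gram_lower. Qed.
Let fu : f^T *m f \in unitmx.
Proof. by apply: gram_unit (mulr_gt0 n1 c20) _; exact: gram_lower. Qed.
Let MP : is_MP L G. Proof. exact: factor_pinv_MP. Qed.

(** [f^T] stretches the range of [f] by sqrt (n c2) and [lam] stretches every vector by sqrt (m c1);
    the scaling removes sqrt (m n). *)
Lemma signal_lower (a : 'cV[R]_r) : c * frob (f *m a) <= frob (L *m (f *m a)).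
Proof.
have sn : s != 0 by rewrite gt_eqF.
rewrite -ler_sqr ?nnegrE ?mulr_ge0 ?sqrtr_ge0// exprMn sqr_sqrtr ?(ltW (mulr_gt0 c10 c20))//.
have h1 := gram_adjoint_lower (mulr_gt0 n1 c20) (gram_lower n0 Hf) a.
have h2 := gram_lower m0 Hlam (f^T *m (f *m a)).
rewrite /L -!scalemxAl frobZ exprMn real_normK ?num_real// -mulmxA.
rewrite exprVn [leRHS]mulrC ler_pdivlMr ?exprn_gt0// s2.
have := ler_wpM2l (ltW (mulr_gt0 m1 c10)) h1; lra.
Qed.

Let g0 : 0 <= g. Proof. by rewrite divr_ge0 ?sqrtr_ge0// ltW. Qed.
Let hG : frob G <= g.
Proof. by apply: (frob_factor_pinv s0 lamu fu c0) => a; exact: signal_lower. Qed.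

Lemma Lprof_phi b : Lprof r Y X b = phi r (A b).
Proof.
rewrite /Lprof /phi; congr inf; have sn : s != 0 by rewrite gt_eqF.
have sE : (m * n)%:R^-1 = s^-1 ^+ 2 by rewrite exprVn s2 natrM.
apply/seteqP; split=> _ [l [h ->]].
  exists (s^-1 *: l), h; rewrite /A -scalemxAl -scalerBr frobZ exprMn sE.
  by rewrite real_normK ?num_real.
exists (s *: l), h; rewrite sE -(real_normK (num_real s^-1)) -exprMn -frobZ scalerBr.
by rewrite -scalemxAl scalerA mulVf// scale1r.
Qed.

Let bdotB a b' : bdot (a - b') X = bdot a X - bdot b' X.
Proof.
by rewrite /bdot -sumrB; apply: eq_bigr => k _; rewrite !mxE scalerBl.
Qed.

Lemma A_decomp b : A b = L + (et - s^-1 *: bdot (b - b0) X).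
Proof.
rewrite /A /Y /Ymodel /L /et -scalemxAl -scalerBr -scalerDr bdotB; congr (_ *: _).
by mx_lin.
Qed.

Lemma frob_bdot h : frob (s^-1 *: bdot h X) <= CX * K%:R * frob h.
Proof.
rewrite frobZ gtr0_norm ?invr_gt0// mulrC ler_pdivrMr//.
apply: (le_trans (ler_frob_sum _ _)).
have -> : CX * K%:R * frob h * s = \sum_(k < K) frob h * (CX * s).
  by rewrite sumr_const card_ord -mulr_natr; ring.
apply: ler_sum => k _; rewrite frobZ ler_pM//; exact: normr_entry_le.
Qed.

Lemma opb_noise b : opb (ee + CX * K%:R * frob (b - b0)) (et - s^-1 *: bdot (b - b0) X).
Proof.
apply: opbB; last by apply: opbW (frob_bdot _) (@opb_frob _ _ _ _).
have := opbZ s^-1 (opb_spec e); apply: opbW.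
by rewrite gtr0_norm ?invr_gt0// mulrC ler_pdivrMr.
Qed.

Let W := Wmat X lam f.
Let C := Cvec X lam f e.

Let MlE : Mproj lam = M. Proof. exact: Mproj_left. Qed.
Let MfE : Mproj f = Mf. Proof. exact: Mproj_right. Qed.

Lemma Wmat_entry j k : W j k = dot (M *m Xt j *m Mf) (Xt k).
Proof.
have [[Mt Mft _ _] _] := is_MP_proj MP; rewrite -/M -/Mf in Mt Mft.
rewrite mxE MlE MfE natrM -s2 /dot !trmx_mul Mt Mft /Xt trmx_scale.
rewrite -!scalemxAl -!scalemxAr -!scalemxAl !linearZ /= mulrA -invfM -expr2.
by rewrite !mulmxA.
Qed.

Lemma Wmat_sym : W^T = W.
Proof.
have [[Mt Mft _ _] _] := is_MP_proj MP; rewrite -/M -/Mf in Mt Mft.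
apply/matrixP => j k; rewrite mxE !Wmat_entry dotC.
by rewrite [RHS]dot_mulr Mft [RHS]dot_mull Mt mulmxA.
Qed.

(** By cyclicity and transposition of the trace, the three traces of C^(2) are, in order, the third,
    second and first terms of [quad_term]. *)
Lemma Cvec_entry k : s^-1 * C 0 k = dot (M *m et *m Mf - quad_term L G et et) (Xt k).
Proof.
have [[Mt Mft _ _] _] := is_MP_proj MP; rewrite -/M -/Mf in Mt Mft.
have sn : s != 0 by rewrite gt_eqF.
have sym k' (S : 'M[R]_k') : S^T = S -> (invmx S)^T = invmx S by rewrite trmx_inv => ->.
have lt : (lam^T *m lam)^T = lam^T *m lam by rewrite trmx_mul trmxK.
have ft : (f^T *m f)^T = f^T *m f by rewrite trmx_mul trmxK.
have GE : f *m invmx (f^T *m f) *m invmx (lam^T *m lam) *m lam^T = s^-1 *: G.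
  by rewrite /G /factor_pinv scalerA mulVf// scale1r.
have GtE : lam *m invmx (lam^T *m lam) *m invmx (f^T *m f) *m f^T = s^-1 *: G^T.
  by rewrite -trmx_scale -GE !trmx_mul trmxK !sym// !mulmxA.
rewrite mxE MlE MfE -/s.
have -> : \tr (Mf *m e^T *m M *m X k) = s ^+ 2 * dot (M *m et *m Mf) (Xt k).
  rewrite /dot !trmx_mul Mt Mft /et /Xt trmx_scale.
  rewrite -!scalemxAr -!scalemxAl -!scalemxAr -!scalemxAl !linearZ /= !mulmxA; by field.
have t1 : \tr (e *m Mf *m e^T *m M *m X k *m f *m invmx (f^T *m f) *m
    invmx (lam^T *m lam) *m lam^T) = s ^+ 2 * dot (M *m et *m Mf *m et^T *m G^T) (Xt k).
  have -> : e *m Mf *m e^T *m M *m X k *m f *m invmx (f^T *m f) *m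
    invmx (lam^T *m lam) *m lam^T = e *m Mf *m e^T *m M *m X k *m (s^-1 *: G).
    by rewrite -GE !mulmxA.
  rewrite mxtrace_mulC /dot !trmx_mul !trmxK Mt Mft /et /Xt !trmx_scale.
  rewrite -!(scalemxAr, scalemxAl) !linearZ /= !mulmxA; by field.
have t2 : \tr (e^T *m M *m e *m Mf *m (X k)^T *m lam *m invmx (lam^T *m lam) *m
    invmx (f^T *m f) *m f^T) = s ^+ 2 * dot (G^T *m et^T *m M *m et *m Mf) (Xt k).
  have -> : e^T *m M *m e *m Mf *m (X k)^T *m lam *m invmx (lam^T *m lam) *m
    invmx (f^T *m f) *m f^T = e^T *m M *m e *m Mf *m (X k)^T *m (s^-1 *: G^T).
    by rewrite -GtE !mulmxA.
  have <- : \tr (et^T *m M *m et *m Mf *m (Xt k)^T *m G^T) =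
      dot (G^T *m et^T *m M *m et *m Mf) (Xt k).
    rewrite -mxtrace_tr /dot !trmx_mul !trmxK Mt Mft.
    by rewrite [in LHS](mulmxA G) [LHS]mxtrace_mulC !mulmxA.
  rewrite /et /Xt !trmx_scale -!(scalemxAr, scalemxAl) !linearZ /=; by field.
have t3 : \tr (e^T *m M *m X k *m Mf *m e^T *m lam *m invmx (lam^T *m lam) *m
    invmx (f^T *m f) *m f^T) = s ^+ 2 * dot (M *m et *m G *m et *m Mf) (Xt k).
  have -> : e^T *m M *m X k *m Mf *m e^T *m lam *m invmx (lam^T *m lam) *m
    invmx (f^T *m f) *m f^T = e^T *m M *m X k *m Mf *m e^T *m (s^-1 *: G^T).
    by rewrite -GtE !mulmxA.
  have <- : \tr (et^T *m M *m Xt k *m Mf *m et^T *m G^T) =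
      dot (M *m et *m G *m et *m Mf) (Xt k).
    have -> : et^T *m M *m Xt k *m Mf *m et^T *m G^T =
      (et^T *m M *m Xt k) *m (Mf *m et^T *m G^T) by rewrite !mulmxA.
    by rewrite mxtrace_mulC /dot !trmx_mul Mt Mft !mulmxA.
  rewrite /et /Xt !trmx_scale -!(scalemxAr, scalemxAl) !linearZ /=; by field.
rewrite t1 t2 t3 dotBl /quad_term -/M -/Mf !dotDl; by field.
Qed.

Let dX h := s^-1 *: bdot h X.

Lemma dot_bdot (Z : 'M[R]_(m, n)) h : dot Z (dX h) = \sum_k h 0 k * dot Z (Xt k).
Proof.
rewrite /dX /bdot dotC scaler_sumr dot_suml; apply: eq_bigr => k _.
by rewrite scalerA mulrC -scalerA dotZl dotC.
Qed.

Lemma bilin_Wmat a h : (a *m W *m h^T) 0 0 = dot (M *m dX a *m Mf) (dX h).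
Proof.
rewrite dot_bdot mxE; apply: eq_bigr => k _; rewrite mxE [h^T _ _]mxE mulrC; congr (_ * _).
have -> : M *m dX a *m Mf = \sum_j a 0 j *: (M *m Xt j *m Mf).
  rewrite /dX /bdot scaler_sumr mulmx_sumr mulmx_suml; apply: eq_bigr => j _.
  by rewrite scalerA mulrC -scalerA -scalemxAr -scalemxAl.
by rewrite dot_suml; apply: eq_bigr => j _; rewrite Wmat_entry dotZl.
Qed.

Lemma lin_Cvec h :
  s^-1 * (h *m C^T) 0 0 = dot (M *m et *m Mf - quad_term L G et et) (dX h).
Proof.
rewrite dot_bdot mxE mulr_sumr; apply: eq_bigr => k _.
by rewrite [C^T _ _]mxE mulrCA Cvec_entry.
Qed.

Lemma frob_row_le k (v : 'rV[R]_k) : frob v <= \sum_j `|v 0 j|.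
Proof.
rewrite {1}[v]row_sum_delta (le_trans (ler_frob_sum _ _))//; apply: ler_sum => j _.
rewrite frobZ ler_piMr// frob_dot dotE big_ord1 (bigD1 j)//= big1 => [|i /negbTE ij].
  by rewrite !mxE !eqxx mulr1 addr0 sqrtr1.
by rewrite !mxE ij mulr0.
Qed.

Variable b : 'rV[R]_K.
Let ex := CX * K%:R * frob (b - b0).
Let x := ee + ex.
Hypothesis xc : 10 * x < c.
Let ex0 : 0 <= ex. Proof. by rewrite !mulr_ge0. Qed.
Let x0 : 0 <= x. Proof. by rewrite addr_ge0. Qed.

(** The envelope gradient pairs -2 D with the regressors. Removing the parts due to [W] and [C]
    turns D into [Z], which is of third order up to quadratic terms containing a regressor. *)
Lemma score_expansion :
  let F := Rrem b0 X lam f e in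
  differentiable F b /\
  frob (grad F b) <= (m * n)%:R * (K%:R * (2 * CX *
    ((16 * g / (c - x) + 54 * g ^+ 2) * x ^+ 3 + 3 * g * (2 * ee * ex + ex ^+ 2)))).
Proof.
move=> F.
have rn : (r <= n)%N.
  by apply: (@mulmx1_min _ _ _ (invmx (f^T *m f) *m f^T) f); rewrite -mulmxA mulVmx.
have [V0 [V0V0 _]] := orthonormal_range (0 : 'M[R]_(n, r)) rn.
have [U hU] := Stiefel_argmax_exists (A b) V0V0.
set B := A b *m (U *m U^T); set D := A b - B.
have e1 : opb x (A b - L) by rewrite A_decomp addrAC subrr add0r; exact: opb_noise.
have gs : gap_split B D (U *m U^T) (c - x) x.
  by apply: Stiefel_argmax_gap fu signal_lower hU x0 e1 _; have := xc; have := x0; lra.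
pose E := et - dX (b - b0).
have hE : opb x E by exact: opb_noise.
have BDE : B + D = L + E by rewrite /D addrC subrK A_decomp.
have hres := resid_expansion MP gs BDE x0 _ _ hE hG.
rewrite -/M -/Mf in hres.
pose Z := D - (M *m E *m Mf - quad_term L G et et).
pose gam := \row_k (- 2 * (m * n)%:R * dot Z (Xt k)).
have gamE h : (h *m gam^T) 0 0 = (m * n)%:R * (- 2 * dot Z (dX h)).
  rewrite dot_bdot mxE mulrA mulr_sumr; apply: eq_bigr => k _.
  by rewrite [gam^T _ _]mxE [gam _ _]mxE; ring.
have x9 : x <= c / 9 by have := xc; have := c0; lra.
(* [xc] bounds the perturbation at [b] by c/10 and this radius adds at most c/90; the total c/9
   satisfies 5 (c/9) < c, as [phi_expansion] requires. The 1 keeps the denominator positive. *)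
pose del := c / 90 / (CX * K%:R + 1).
have CK : 0 <= CX * K%:R by rewrite mulr_ge0.
have del0 : 0 < del by rewrite /del !divr_gt0//; have := c0; lra.
have CF h : frob h <= del ->
    `|F (b + h) - F b - (h *m gam^T) 0 0| <=
    (m * n)%:R * (3 * (CX * K%:R) ^+ 2 + frob W) * frob h ^+ 2.
  move=> hd.
  have [U2 hU2] := Stiefel_argmax_exists (A (b + h)) V0V0.
  have e2 : opb (c / 9) (A (b + h) - L).
    rewrite A_decomp addrAC subrr add0r; apply: opbW (opb_noise _).
    have t1 : frob (b + h - b0) <= frob (b - b0) + frob h.
      by rewrite addrAC ler_frobD.
    have t2 : CX * K%:R * frob h <= c / 90.
      move: hd; rewrite /del ler_pdivlMr; last lra.
      by have := frob_ge0 h; lra.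
    have := ler_wpM2l CK t1; rewrite mulrDr -/ex => t3.
    by have := xc; rewrite /x; lra.
  have AB : A (b + h) - A b = - dX h.
    rewrite !A_decomp -/(dX _) -/(dX _) /dX.
    have -> : b + h - b0 = (b - b0) - (- h) by rewrite opprK addrAC.
    rewrite bdotB scalerBr; have -> : bdot (- h) X = - bdot h X.
      by rewrite -[- h]sub0r bdotB (_ : bdot 0 X = 0) ?sub0r// /bdot big1// => k _; rewrite mxE scale0r.
    by rewrite scalerN; mx_lin.
  have c9 : 0 <= c / 9 by have := c0; lra.
  have c5 : 5 * (c / 9) < c by have := c0; lra.
  have := phi_expansion fu signal_lower c9 c5 hU hU2 (opbW x9 e1) e2.
  rewrite AB frobN dotNr -/B -/D => /le_trans tr.
  have t1 : frob (dX h) ^+ 2 <= (CX * K%:R) ^+ 2 * frob h ^+ 2.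
    by rewrite -exprMn ler_sqr ?nnegrE ?mulr_ge0//; exact: frob_bdot.
  have t2 : `|(h *m W *m h^T) 0 0| <= frob W * frob h ^+ 2.
    apply: le_trans (normr_entry_le _ _ _) _; apply: le_trans (frob_mul _ _) _.
    rewrite frob_tr expr2 mulrA ler_wpM2r//.
    by apply: le_trans (frob_mul _ _) _; rewrite mulrC.
  (* The increments of the linear form in [C] and of the quadratic form in [W] are exact; only [phi]
     is approximated. *)
  have FE : F (b + h) - F b - (h *m gam^T) 0 0 = (m * n)%:R *
     (phi r (A (b + h)) - phi r (A b) - 2 * - dot D (dX h) - (h *m W *m h^T) 0 0).
    rewrite gamE /F /Rrem -/Y !Lprof_phi -/s.
    have dbE : b + h - b0 = (b - b0) + h by rewrite addrAC.
    have c1' : (((b + h - b0) *m W *m (b + h - b0)^T) 0 0) =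
       ((b - b0) *m W *m (b - b0)^T) 0 0 + 2 * dot (M *m dX (b - b0) *m Mf) (dX h)
       + (h *m W *m h^T) 0 0.
      have sw : (h *m W *m (b - b0)^T) 0 0 = ((b - b0) *m W *m h^T) 0 0.
        have -> : h *m W *m (b - b0)^T = ((b - b0) *m W *m h^T)^T.
          by rewrite !trmx_mul trmxK Wmat_sym mulmxA.
        by rewrite mxE.
      rewrite dbE raddfD /= (mulmxDl _ _ W) mulmxDr !(mulmxDl ((b - b0) *m W)) !addmx_entry sw.
      by rewrite (bilin_Wmat (b - b0) h); ring.
    have c2' : ((b + h - b0) *m C^T) 0 0 = ((b - b0) *m C^T) 0 0 + (h *m C^T) 0 0.
      by rewrite dbE mulmxDl addmx_entry.
    rewrite -/W -/C c1' c2'.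
    have ZE : dot Z (dX h) = dot D (dX h) - s^-1 * (h *m C^T) 0 0
        + dot (M *m dX (b - b0) *m Mf) (dX h).
      rewrite lin_Cvec -dotBl -dotDl; congr dot.
      by rewrite /Z /E (mulmxBr M) (mulmxBl _ _ Mf); mx_lin.
    rewrite ZE; move: (phi r (A (b + h))) (phi r (A b)) (phi r (A b0)) (dot D (dX h))
      (((b - b0) *m C^T) 0 0) ((h *m C^T) 0 0) ((h *m W *m h^T) 0 0)
      (((b - b0) *m W *m (b - b0)^T) 0 0) (dot (M *m dX (b - b0) *m Mf) (dX h))
      ((m * n)%:R : R) (s^-1) => ? ? ? ? ? ? ? ? ? ? ?.
    by ring.
  rewrite FE normrM ger0_norm ?ler0n// -mulrA ler_wpM2l ?ler0n//.
  apply: le_trans (ler_normB _ _) _; rewrite [leRHS]mulrDl lerD//.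
  by apply: tr; rewrite -mulrA ler_wpM2l.
have [dF gF] := quadratic_remainder_diff del0 CF; split=> //.
rewrite gF; apply: le_trans (frob_row_le _) _.
have hZ : frob Z <= (16 * g / (c - x) + 54 * g ^+ 2) * x ^+ 3 + 3 * g * (2 * ee * ex + ex ^+ 2).
  have het : opb ee et.
    by have := opbZ s^-1 (opb_spec e); apply: opbW; rewrite gtr0_norm ?invr_gt0// mulrC ler_pdivrMr.
  have hdX : opb ex (- dX (b - b0)) by apply/opbN/(opbW (frob_bdot _))/opb_frob.
  (* [Z] involves the quadratic term of the noise alone, so the three terms with a regressor factor
     are bounded separately. *)
  have -> : Z = D - (M *m E *m Mf - quad_term L G E E)
     - (quad_term L G et (- dX (b - b0)) + quad_term L G (- dX (b - b0)) et
        + quad_term L G (- dX (b - b0)) (- dX (b - b0))).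
    rewrite /Z {3 4}/E quad_term_split; move: (quad_term L G et et) (quad_term L G et _)
      (quad_term L G _ et) (quad_term L G _ _) (M *m E *m Mf) => q1 q2 q3 q4 q5.
    by mx_lin.
  apply: le_trans (ler_frobB _ _) _; apply: lerD.
    by apply: hres; have := xc; have := x0; lra.
  apply: le_trans (ler_frobD _ _) _; apply: le_trans (lerD (ler_frobD _ _) (lexx _)) _.
  have q1 := frob_quad_term MP ee0 ex0 het hdX hG.
  have q2 := frob_quad_term MP ex0 ee0 hdX het hG.
  have q3 := frob_quad_term MP ex0 ex0 hdX hdX hG.
  by lra.
set bd := _ + 3 * g * _ in hZ *.
have -> : (m * n)%:R * (K%:R * (2 * CX * bd)) = \sum_(k < K) (m * n)%:R * (2 * (bd * CX)).
  by rewrite sumr_const card_ord -mulr_natr; ring.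
apply: ler_sum => k _; rewrite [gam _ _]mxE.
have hX : frob (Xt k) <= CX.
  by rewrite frobZ gtr0_norm ?invr_gt0// mulrC ler_pdivrMr.
have hd : `|dot Z (Xt k)| <= bd * CX.
  by apply: le_trans (normr_dot_le _ _) _; rewrite ler_pM.
rewrite -mulrA mulNr normrN normrM ger0_norm// mulrCA ler_wpM2l ?ler0n//.
by rewrite normrM ger0_norm ?ler0n// ler_wpM2l ?ler0n.
Qed.

End Score.

(** * Uniformity and probability *)

Section Uniform.
Variable R : realType.

Lemma frob_le_entries m n (A : 'M[R]_(m, n)) d :
  (forall i j, `|A i j| <= d) -> frob A <= (m * n)%:R * d.
Proof.
move=> h; have [mn0|mn0] := posnP (m * n)%N.
  rewrite frob_dot dotE mn0 mul0r big1 ?sqrtr0// => i _; rewrite big1// => j _.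
  have : (0 < m * n)%N.
    by rewrite muln_gt0 (leq_trans _ (ltn_ord i))// (leq_trans _ (ltn_ord j)).
  by rewrite mn0.
have [i j] : 'I_m * 'I_n.
  by move: mn0; rewrite muln_gt0 => /andP[a b]; exact: (Ordinal a, Ordinal b).
have d0 : 0 <= d by exact: le_trans (h i j).
rewrite -ler_sqr ?nnegrE ?mulr_ge0// frob_sq dotE.
apply: (@le_trans _ _ ((m * n)%:R * d ^+ 2)).
  rewrite natrM -mulrA mulr_natl -[X in _ *+ X](card_ord m) -sumr_const.
  apply: ler_sum => i' _; rewrite mulr_natl -[X in _ *+ X](card_ord n) -sumr_const.
  by apply: ler_sum => j' _; rewrite -expr2 -real_normK ?num_real// ler_sqr ?nnegrE.
by rewrite exprMn ler_wpM2r ?sqr_ge0// expr2 ler_peMr// ler1n.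
Qed.

(** Half of the coercivity pays for the perturbation. The hypothesis is entrywise because the limits
    in probability are. *)
Lemma coercive_perturb k (S A : 'M[R]_k) c : 0 < c ->
  (forall v : 'rV[R]_k, c * frob v ^+ 2 <= (v *m S *m v^T) 0 0) ->
  (forall i j, `|A i j - S i j| <= c / 2 / ((k * k)%:R + 1)) ->
  forall v : 'rV[R]_k, c / 2 * frob v ^+ 2 <= (v *m A *m v^T) 0 0.
Proof.
move=> c0 hS hA v; have k0 := ler0n R (k * k).
have h1 : frob (A - S) <= c / 2.
  have h : forall i j, `|(A - S) i j| <= c / 2 / ((k * k)%:R + 1).
    by move=> i j; rewrite !mxE.
  apply: le_trans (frob_le_entries h) _.
  rewrite mulrA ler_pdivrMr; last by lra.
  by lra.
have h2 : `|(v *m (A - S) *m v^T) 0 0| <= c / 2 * frob v ^+ 2.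
  apply: le_trans (normr_entry_le _ _ _) _; apply: le_trans (frob_mul _ _) _.
  rewrite frob_tr expr2 mulrA ler_wpM2r//; apply: le_trans (frob_mul _ _) _.
  by rewrite mulrC ler_wpM2r.
have -> : A = S + (A - S) by rewrite addrC subrK.
rewrite mulmxDr mulmxDl addmx_entry; have := hS v.
by move: h2; rewrite ler_norml => /andP[]; lra.
Qed.

(* [t] bounds both [|b - b0|] and the noise level [|e| / s], [s = sqrt (m n)]; the
   cubic condition is where [|e| = o(N^(2/3))] enters. *)
Lemma score_uniform (K r : nat) (c1 c2 CX eps : R) :
  0 < c1 -> 0 < c2 -> 0 <= CX -> 0 < eps ->
  exists2 t : R, 0 < t & forall (m n : nat) (X : 'I_K -> 'M[R]_(m, n)) (lam : 'M[R]_(m, r))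
    (f : 'M[R]_(n, r)) (e : 'M[R]_(m, n)) (b0 b : 'rV[R]_K) (ee : R),
  let s := Num.sqrt (m * n)%:R in
  (0 < m)%N -> (0 < n)%N ->
  (forall v : 'rV[R]_r, c1 * frob v ^+ 2 <= (v *m (m%:R^-1 *: (lam^T *m lam)) *m v^T) 0 0) ->
  (forall v : 'rV[R]_r, c2 * frob v ^+ 2 <= (v *m (n%:R^-1 *: (f^T *m f)) *m v^T) 0 0) ->
  (forall k, frob (X k) <= CX * s) ->
  0 <= ee -> ee <= t -> s * ee ^+ 3 <= t ^+ 3 ->
  spec e <= ee * s -> frob (b - b0) <= t ->
  differentiable (Rrem b0 X lam f e) b /\
  frob (grad (Rrem b0 X lam f e) b) / (s * (1 + s * frob (b - b0))) <= eps.
Proof.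
move=> c10 c20 CX0 eps0.
pose c := Num.sqrt (c1 * c2); pose g := Num.sqrt r%:R / c.
have c0 : 0 < c by rewrite sqrtr_gt0 mulr_gt0.
have g0 : 0 <= g by rewrite divr_ge0 ?sqrtr_ge0// ltW.
pose a := CX * K%:R; have a0 : 0 <= a by rewrite mulr_ge0.
pose H := 32 * g / c + 54 * g ^+ 2.
have H0 : 0 <= H.
  by rewrite addr_ge0// mulr_ge0 ?invr_ge0 ?(ltW c0) ?sqr_ge0// mulr_ge0.
pose Q := 4 * H * (1 + a ^+ 3) + 3 * g * (2 * a + a ^+ 2).
have p3 : 0 <= 1 + a ^+ 3 by rewrite addr_ge0 ?exprn_ge0.
have p2 : 0 <= 2 * a + a ^+ 2 by rewrite addr_ge0 ?exprn_ge0// mulr_ge0.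
have Q0 : 0 <= Q by rewrite addr_ge0// mulr_ge0// mulr_ge0.
pose Ct := K%:R * (2 * CX * Q); have Ct0 : 0 <= Ct by rewrite !mulr_ge0.
(* The three bounds serve the comparison of powers of [t], the final estimate Ct t <= eps, and 10
   (ee + a |b - b0|) < c, where 11 gives strictness. *)
pose t := Num.min 1 (Num.min (eps / (Ct + 1)) (c / (11 * (1 + a)))).
have t1 : t <= 1 by rewrite ge_min lexx.
have t2 : t <= eps / (Ct + 1) by rewrite !ge_min lexx !orbT.
have t3 : t <= c / (11 * (1 + a)) by rewrite !ge_min lexx !orbT.
have t0 : 0 < t.
  have p0 : 0 < Ct + 1 by lra.
  have p1 : 0 < 11 * (1 + a) by lra.
  by rewrite !lt_min ltr01 !divr_gt0.
exists t => // m n X lam f e b0 b ee s m0 n0 Hlam Hf HX ee0 eet set3 He bt.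
set fd := frob (b - b0) in bt *; have fd0 : 0 <= fd by exact: frob_ge0.
have tc : 11 * t * (1 + a) <= c.
  by move: t3; rewrite ler_pdivlMr; lra.
have at0 : a * fd <= a * t by rewrite ler_wpM2l.
have xc : 10 * (ee + CX * K%:R * fd) < c by rewrite -/a; nra.
have [dF gF] := score_expansion m0 n0 c10 c20 Hlam Hf CX0 HX ee0 He xc.
split=> //; rewrite -/c -/g -/a -/fd in gF.
have s0 : 0 < s by rewrite sqrtr_gt0 ltr0n muln_gt0 m0.
have s2 : s ^+ 2 = (m * n)%:R by rewrite sqr_sqrtr ?ler0n.
have sf0 : 0 <= s * fd by rewrite mulr_ge0// ltW.
set ex := a * fd in gF at0; have ex0 : 0 <= ex by rewrite mulr_ge0.
rewrite ler_pdivrMr; last by rewrite mulr_gt0//; lra.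
apply: (le_trans gF); rewrite -s2 expr2.
have gc : 16 * g / (c - (ee + ex)) <= 32 * g / c.
  rewrite ler_pdivrMr; last by rewrite -/ex in xc; lra.
  rewrite mulrAC ler_pdivlMr//; have : 0 <= g * (c - 2 * (ee + ex)).
    by rewrite mulr_ge0//; rewrite -/a -/ex in xc; lra.
  by lra.
have x3 : (ee + ex) ^+ 3 <= 4 * (ee ^+ 3 + ex ^+ 3).
  rewrite -subr_ge0.
  have -> : 4 * (ee ^+ 3 + ex ^+ 3) - (ee + ex) ^+ 3 = 3 * (ee + ex) * (ee - ex) ^+ 2 by ring.
  by rewrite mulr_ge0 ?sqr_ge0// mulr_ge0 ?addr_ge0.
(* Each term with a factor [ex] is s |b - b0|, which the weight in the denominator absorbs, times
   something of order [t]. The pure noise cube in [k4] rests on the cubic condition instead. *)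
have k1 : s * ex ^+ 3 <= a ^+ 3 * t * (s * fd).
  have -> : s * ex ^+ 3 = a ^+ 3 * fd ^+ 2 * (s * fd) by rewrite /ex; ring.
  rewrite ler_wpM2r// ler_wpM2l ?exprn_ge0//; nra.
have k2 : s * (ee * ex) <= a * t * (s * fd).
  have -> : s * (ee * ex) = a * ee * (s * fd) by rewrite /ex; ring.
  by rewrite ler_wpM2r// ler_wpM2l.
have k3 : s * ex ^+ 2 <= a ^+ 2 * t * (s * fd).
  have -> : s * ex ^+ 2 = a ^+ 2 * fd * (s * fd) by rewrite /ex; ring.
  by rewrite ler_wpM2r// ler_wpM2l ?exprn_ge0.
have k4 : s * ee ^+ 3 <= t.
  apply: le_trans set3 _; rewrite exprS ler_piMr ?(ltW t0)//.
  by rewrite exprn_ile1// ltW.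
have bound : s * ((16 * g / (c - (ee + ex)) + 54 * g ^+ 2) * (ee + ex) ^+ 3
    + 3 * g * (2 * ee * ex + ex ^+ 2)) <= Q * t * (1 + s * fd).
  apply: (@le_trans _ _ (s * (H * (4 * (ee ^+ 3 + ex ^+ 3)) + 3 * g * (2 * ee * ex + ex ^+ 2)))).
    rewrite ler_wpM2l ?(ltW s0)// lerD2r ler_pM ?exprn_ge0 ?addr_ge0//.
    - by rewrite mulr_ge0 ?mulr_ge0// invr_ge0; rewrite -/a -/ex in xc; lra.
    - by rewrite mulr_ge0 ?sqr_ge0.
    - by rewrite lerD2r.
  have j1 := ler_wpM2l H0 k1; have j4 := ler_wpM2l H0 k4.
  have j2 := ler_wpM2l g0 k2; have j3 := ler_wpM2l g0 k3.
  have z1 : 0 <= H * a ^+ 3 * t by rewrite mulr_ge0 ?(ltW t0)// mulr_ge0 ?exprn_ge0.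
  have z2 : 0 <= H * t * (s * fd) by rewrite mulr_ge0// mulr_ge0// ltW.
  have z3 : 0 <= g * (2 * a + a ^+ 2) * t by rewrite mulr_ge0 ?(ltW t0)// mulr_ge0.
  by rewrite /Q; lra.
have CtE : Ct * t <= eps.
  by move: t2; rewrite ler_pdivlMr; lra.
have KC : 0 <= K%:R * (2 * CX) by rewrite !mulr_ge0.
have b1 := ler_wpM2l KC bound.
have b2 : Ct * t * (1 + s * fd) <= eps * (1 + s * fd) by rewrite ler_wpM2r//; lra.
have b3 := ler_wpM2l (ltW s0) (le_trans b1 (le_trans (_ : _ <= Ct * t * (1 + s * fd)) b2)).
rewrite [leRHS]mulrCA; apply: le_trans (b3 _) => //; last by rewrite /Ct; lra.
by lra.
Qed.

End Uniform.

(** * Events of vanishing outer probability *)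

Section Vanishing.
Variable R : realType.
Variables (d : measure_display) (Omega : measurableType d) (P : probability Omega R).

Lemma vanishing_sub (A B : nat -> set Omega) :
  (\forall n \near \oo, A n `<=` B n) -> vanishing P B -> vanishing P A.
Proof.
move=> AB vB delta d0; have := vB _ d0; move: AB; apply: filterS2 => n AB [C [mC BC PC]].
by exists C; split=> //; exact: subset_trans BC.
Qed.

Lemma vanishing_setU (A B : nat -> set Omega) :
  vanishing P A -> vanishing P B -> vanishing P (fun n => A n `|` B n).
Proof.
move=> vA vB delta d0; have d2 : 0 < delta / 2 by rewrite divr_gt0.
have := vB _ d2; have := vA _ d2; apply: filterS2 => n [C [mC AC PC]] [D [mD BD PD]].
exists (C `|` D); split; [exact: measurableU|exact: setUSS|].
apply: le_trans (measureU2 P mC mD) _.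
by rewrite [delta]splitr EFinD leeD.
Qed.

(** Needed because convergence in probability of a matrix gives one vanishing event per entry. *)
Lemma vanishing_exists (I : finType) (A : I -> nat -> set Omega) :
  (forall i, vanishing P (A i)) -> vanishing P (fun n => [set w | exists i, A i n w]).
Proof.
move=> vA.
suff h (s : seq I) : vanishing P (fun n => [set w | exists2 i, i \in s & A i n w]).
  apply: vanishing_sub (h (enum I)); near=> n => w [i Ai]; exists i => //.
  by rewrite mem_enum.
elim: s => [|i s IH].
  move=> delta d0; near=> n; exists set0; split=> //; last by rewrite measure0 lee_fin ltW.
  by move=> w [].
apply: vanishing_sub (vanishing_setU (vA i) IH); near=> n => w [j].
by rewrite inE => /predU1P[-> ?|js ?]; [left|right; exists j].
Unshelve. all: by end_near. Qed.

End Vanishing.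

Theorem theorem6 (R : realType) (d : measure_display) (Omega : measurableType d)
  (P : probability Omega R) (K r : nat) (beta0 : 'rV[R]_K) (kappa : R)
  (N T : nat -> nat)
  (X : forall n, Omega -> 'I_K -> 'M[R]_(N n, T n))
  (e : forall n, Omega -> 'M[R]_(N n, T n))
  (lam0 : forall n, Omega -> 'M[R]_(N n, r))
  (f0 : forall n, Omega -> 'M[R]_(T n, r)) :
  0 < kappa ->
  (forall M : nat, \forall n \near \oo, (M <= N n)%N) ->
  (forall M : nat, \forall n \near \oo, (M <= T n)%N) ->
  ((N n)%:R / (T n)%:R : R) @[n --> \oo] --> kappa ^+ 2 ->
  (* Assumption 1 *)
  (exists S : 'M[R]_r, posdef S /\
     plim_mx P (fun n w => (N n)%:R^-1 *: ((lam0 n w)^T *m lam0 n w)) S) ->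
  (exists S : 'M[R]_r, posdef S /\
     plim_mx P (fun n w => (T n)%:R^-1 *: ((f0 n w)^T *m f0 n w)) S) ->
  (* Assumption 3* : ||e|| = o_p(N^{2/3}) *)
  op1 P (fun n w => spec (e n w) / (N n)%:R `^ (2 / 3)) ->
  (* Assumption 4(i) *)
  (exists S : 'M[R]_K, posdef S /\
     plim_mx P (fun n w => (N n * T n)%:R^-1 *:
        \matrix_(k1 < K, k2 < K)
          (\sum_(i < N n) \sum_(t < T n) X n w k1 i t * X n w k2 i t)) S) ->
  forall eta : nat -> R, eta n @[n --> \oo] --> 0 ->
  forall eps : R, 0 < eps ->
  vanishing P (fun n => [set w |
     exists b : 'rV[R]_K, frob (b - beta0) <= eta n /\
       (~ differentiable (Rrem beta0 (X n w) (lam0 n w) (f0 n w) (e n w)) b \/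
        (eps%:E < ereal_sup [set y : \bar R | exists2 b : 'rV[R]_K,
            (frob (b - beta0) <= eta n)%R &
            y = (frob (grad (Rrem beta0 (X n w) (lam0 n w) (f0 n w) (e n w)) b)
                 / (Num.sqrt (N n * T n)%:R
                    * (1 + Num.sqrt (N n * T n)%:R * frob (b - beta0))))%R%:E])%E)]).
Proof.
move=> kappa0 Ninf Tinf NT [S1 [pS1 h1]] [S2 [pS2 h2]] h3 [S4 [_ h4]] eta eta0 eps eps0.
have [c1 c10 hc1] := posdef_coercive pS1; have [c2 c20 hc2] := posdef_coercive pS2.
have rr0 : 0 < (r * r)%:R + 1 :> R by have := ler0n R (r * r); lra.
pose d1 := c1 / 2 / ((r * r)%:R + 1); pose d2 := c2 / 2 / ((r * r)%:R + 1).
have d10 : 0 < d1 by rewrite /d1 !divr_gt0.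
have d20 : 0 < d2 by rewrite /d2 !divr_gt0.
(* The 1 is the tolerated deviation of the diagonal entries from their limits. It also gives
   [CX >= 1], so that a bound [CX] on |X_k|^2 / s^2 is one on |X_k| / s. *)
pose CX := 1 + \sum_k `|S4 k k|.
have CX1 : 1 <= CX by rewrite lerDl sumr_ge0.
have CX0 : 0 <= CX by lra.
have [t t0 ht] := @score_uniform R K r (c1 / 2) (c2 / 2) CX eps ltac:(lra) ltac:(lra) CX0 eps0.
pose q := kappa ^+ 2 + 1; have q1 : 1 <= q by rewrite lerDr sqr_ge0.
have q0 : 0 < q by lra.
(* With this noise level, s ee^3 = e3^3 N/T <= e3^3 q = t^3 / q^2 <= t^3. *)
pose e3 := t / q; have e30 : 0 < e3 by rewrite divr_gt0.
have v1 := vanishing_exists (fun ij : 'I_r * 'I_r => h1 ij.1 ij.2 _ d10).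
have v2 := vanishing_exists (fun ij : 'I_r * 'I_r => h2 ij.1 ij.2 _ d20).
have v4 := vanishing_exists (fun k : 'I_K => h4 k k _ ltr01).
have vU := vanishing_setU (vanishing_setU v1 v2) (vanishing_setU (h3 _ e30) v4).
have NTq : \forall n \near \oo, (N n)%:R / (T n)%:R <= q.
  by apply: (cvgr_le _ NT); rewrite /q ltrDl.
have etat := cvgr_le _ eta0 _ t0.
apply: vanishing_sub vU; near=> n => w [b [hb H]].
have N0 : (0 < N n)%N by near: n; exact: (Ninf 1%N).
have T0 : (0 < T n)%N by near: n; exact: (Tinf 1%N).
have NTn : (N n)%:R / (T n)%:R <= q by near: n; exact: NTq.
have etan : eta n <= t by near: n; exact: etat.
(* Off the four bad events every hypothesis of [score_uniform] holds at [w], and the rest is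
   deterministic. *)
apply: contrapT => /not_orP[/not_orP[g1 g2] /not_orP[g3 g4]].
set s : R := Num.sqrt (N n * T n)%:R.
have N1 : 0 < (N n)%:R :> R by rewrite ltr0n.
have T1 : 0 < (T n)%:R :> R by rewrite ltr0n.
have s2 : s ^+ 2 = (N n)%:R * (T n)%:R by rewrite sqr_sqrtr ?ler0n// natrM.
have s0 : 0 < s by rewrite sqrtr_gt0 ltr0n muln_gt0 N0.
have s1 : 1 <= s by rewrite -(@sqrtr1 R) ler_wsqrtr// ler1n muln_gt0 N0.
pose p : R := (N n)%:R `^ (2 / 3).
have p0 : 0 < p by rewrite powR_gt0.
(* The exponent 2/3 enters here: p^3 = N^2 turns s ee^3 into a multiple of N/T. *)
have p3 : p ^+ 3 = (N n)%:R ^+ 2.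
  rewrite -powR_mulrn ?(ltW p0)// -powRrM divfK ?pnatr_eq0//.
  by rewrite powR_mulrn ?ler0n.
pose ee := e3 * p / s.
have ee0 : 0 <= ee by rewrite divr_ge0 ?(ltW s0)// mulr_ge0 ?(ltW e30) ?(ltW p0).
have see3 : s * ee ^+ 3 <= t ^+ 3.
  have -> : s * ee ^+ 3 = e3 ^+ 3 * ((N n)%:R / (T n)%:R).
    rewrite /ee !exprMn exprVn p3.
    have -> : (T n)%:R = s ^+ 2 / (N n)%:R by rewrite s2 mulrAC mulfV ?mul1r// gt_eqF.
    by field; rewrite !gt_eqF.
  apply: (@le_trans _ _ (e3 ^+ 3 * q)); first by rewrite ler_wpM2l// exprn_ge0// ltW.
  have -> : e3 ^+ 3 * q = t ^+ 3 / q ^+ 2 by rewrite /e3; field; rewrite gt_eqF.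
  by rewrite ler_pdivrMr ?exprn_gt0 ?ler_peMr ?exprn_ge0 ?(ltW t0)// ?exprn_ege1//; lra.
(* As s >= 1, the cubic bound also gives the linear one. *)
have eet : ee <= t.
  rewrite -(@ler_pXn2r _ 3)// ?nnegrE ?(ltW t0)//; apply: le_trans see3.
  by rewrite ler_peMl// exprn_ge0.
have He : spec (e n w) <= ee * s.
  rewrite /ee divfK ?gt_eqF//; move/negP: g3; rewrite /= -leNgt.
  by rewrite ger0_norm ?divr_ge0 ?spec_ge0 ?(ltW p0)// ler_pdivrMr.
have Hlam : forall v : 'rV[R]_r, c1 / 2 * frob v ^+ 2 <=
    (v *m ((N n)%:R^-1 *: ((lam0 n w)^T *m lam0 n w)) *m v^T) 0 0.
  apply: (coercive_perturb c10 hc1) => i j; rewrite leNgt; apply/negP => h.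
  by apply: g1; exists (i, j).
have Hf : forall v : 'rV[R]_r, c2 / 2 * frob v ^+ 2 <=
    (v *m ((T n)%:R^-1 *: ((f0 n w)^T *m f0 n w)) *m v^T) 0 0.
  apply: (coercive_perturb c20 hc2) => i j; rewrite leNgt; apply/negP => h.
  by apply: g2; exists (i, j).
have HX k : frob (X n w k) <= CX * s.
  have : ~ (1 < `|((N n * T n)%:R^-1 *: \matrix_(k1 < K, k2 < K)
     (\sum_(i < N n) \sum_(t < T n) X n w k1 i t * X n w k2 i t)) k k - S4 k k|).
    by move=> h; apply: g4; exists k.
  move/negP; rewrite -leNgt scalemx_entry mxE -dotE -frob_sq => h.
  have Sk : S4 k k + 1 <= CX.
    rewrite addrC lerD2l (bigD1 k)//= (le_trans (ler_norm _))// lerDl sumr_ge0//.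
  have h5 : (N n * T n)%:R^-1 * frob (X n w k) ^+ 2 <= CX.
    by move: h; rewrite ler_norml => /andP[_]; lra.
  rewrite -ler_sqr ?nnegrE ?mulr_ge0 ?(ltW s0)//.
  rewrite mulrC ler_pdivrMr ?ltr0n ?muln_gt0 ?N0// natrM -s2 in h5.
  by apply: (le_trans h5); rewrite exprMn ler_wpM2r ?sqr_ge0// expr2 ler_peMr.
have main b' (h : frob (b' - beta0) <= eta n) :=
  ht _ _ (X n w) (lam0 n w) (f0 n w) (e n w) beta0 b' ee N0 T0 Hlam Hf HX ee0 eet see3 He
    (le_trans h etan).
case: H => [nd|].
  by apply: nd; case: (main _ hb).
apply/negP; rewrite -leNgt; apply: ge_ereal_sup => _ [b' hb' ->].
by rewrite lee_fin; case: (main _ hb').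
Unshelve. all: by end_near. Qed.
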